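(* Let $C>0$, let $x\in\mathbb{R}$ with $|x|\le C$, let $\epsilon$ be a real number with $0<\epsilon<\min\{1,2C\}$, and let $0<t<\frac{\epsilon^{2}}{4\pi^{2}C^{2}}$ (so that in particular $t<\frac{\epsilon^{2}}{4\pi^{2}C^{2}}<1$). Then $$t^{\frac12}\,\theta_{1}\!\left(\tfrac12+\sqrt{t}\,x\,\big|\, it\right)=e^{-\pi x^{2}}\left(1+R_{21}(x,t)\right),$$ $$t^{\frac12}\,\theta_{2}\!\left(\sqrt{t}\,x\,\big|\, it\right)=e^{-\pi x^{2}}\left(1+R_{22}(x,t)\right),$$ $$t^{\frac12}\,\theta_{3}\!\left(\sqrt{t}\,x\,\big|\, it\right)=e^{-\pi x^{2}}\left(1+R_{23}(x,t)\right),$$ $$t^{\frac12}\,\theta_{4}\!\left(\tfrac12+\sqrt{t}\,x\,\big|\, it\right)=e^{-\pi x^{2}}\left(1+R_{24}(x,t)\right),$$ where the remainders $R_{2j}(x,t)$ (defined by these identities) satisfy $$\left|R_{2j}(x,t)\right|\le\frac{4-2e^{-\pi}}{1-e^{-\pi}}\,e^{-(\pi-\epsilon)/t},\qquad j=1,2,3,4.$$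
   Context: For $v\in\mathbb{C}$ and $\tau\in\mathbb{C}$ with $\Im(\tau)>0$, put $q=e^{\pi i\tau}$, with the convention $q^{s}=e^{\pi i\tau s}$ for real $s$. The Jacobi theta functions are $$\theta_{1}(v|\tau)=-i\sum_{n=-\infty}^{\infty}(-1)^{n}q^{(n+1/2)^{2}}e^{(2n+1)\pi iv},\qquad \theta_{2}(v|\tau)=\sum_{n=-\infty}^{\infty}q^{(n+1/2)^{2}}e^{(2n+1)\pi iv},$$ $$\theta_{3}(v|\tau)=\sum_{n=-\infty}^{\infty}q^{n^{2}}e^{2\pi inv},\qquad \theta_{4}(v|\tau)=\sum_{n=-\infty}^{\infty}(-1)^{n}q^{n^{2}}e^{2\pi inv}.$$ *)

(* Defs.v *)
From Stdlib Require Import Reals ZArith Lra.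
From Coquelicot Require Import Coquelicot.

Open Scope R_scope.

Definition Cexp (z : C) : C :=
  (exp (Re z) * cos (Im z), exp (Re z) * sin (Im z)).

(* Coquelicot's total operator [Series] is real-valued, so a complex series is
   summed componentwise; [CSeries_unique] relates this to convergence in [C]. *)
Definition CSeries (a : nat -> C) : C :=
  (Series (fun n => Re (a n)), Series (fun n => Im (a n))).

Lemma CSeries_unique (a : nat -> C) (l : C) :
  is_series (V := C_R_NormedModule) a l -> CSeries a = l.
Proof.
intros H.
assert (Hre : forall n, Re (sum_n (G := C_AbelianMonoid) a n)
                        = sum_n (fun k => Re (a k)) n).
{ induction n as [|n IH]; [now rewrite !sum_O|].
  rewrite !sum_Sn, <- IH. reflexivity. }
assert (Him : forall n, Im (sum_n (G := C_AbelianMonoid) a n)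
                        = sum_n (fun k => Im (a k)) n).
{ induction n as [|n IH]; [now rewrite !sum_O|].
  rewrite !sum_Sn, <- IH. reflexivity. }
destruct l as [l1 l2].
unfold CSeries; f_equal; apply is_series_unique; intros P [eps HP];
  (destruct (H (ball (M := C_UniformSpace) (l1, l2) eps)) as [N HN];
   [now exists eps|]);
  exists N; intros n Hn; apply HP; destruct (HN n Hn) as [B1 B2].
- rewrite <- Hre. exact B1.
- rewrite <- Him. exact B2.
Qed.

(* The sum over all integers, as the sum over n >= 0 plus the sum over n <= -1;
   the theta series below converge absolutely for 0 < Im tau, so the order of
   summation is immaterial. *)
Definition CSeriesZ (a : Z -> C) : C :=
  (CSeries (fun n => a (Z.of_nat n)) +
   CSeries (fun n => a (- Z.of_nat (S n))%Z))%C.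

(* q^s with q = e^(pi i tau), taken as e^(pi i tau s) to fix the branch. *)
Definition qpow (tau : C) (s : R) : C := Cexp (PI * Ci * tau * s)%C.

(* The four functions are meaningful for 0 < Im tau only. *)
Definition theta1 (v tau : C) : C :=
  (- Ci * CSeriesZ (fun n : Z =>
     RtoC (powerRZ (-1) n) * qpow tau ((IZR n + 1 / 2) ^ 2)%R *
     Cexp (RtoC (2 * IZR n + 1)%R * PI * Ci * v)))%C.

Definition theta2 (v tau : C) : C :=
  CSeriesZ (fun n : Z =>
    qpow tau ((IZR n + 1 / 2) ^ 2)%R *
    Cexp (RtoC (2 * IZR n + 1)%R * PI * Ci * v))%C.

Definition theta3 (v tau : C) : C :=
  CSeriesZ (fun n : Z =>
    qpow tau (IZR n ^ 2)%R * Cexp (2 * PI * Ci * IZR n * v))%C.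

Definition theta4 (v tau : C) : C :=
  CSeriesZ (fun n : Z =>
    RtoC (powerRZ (-1) n) * qpow tau (IZR n ^ 2)%R *
    Cexp (2 * PI * Ci * IZR n * v))%C.

(* The remainders are the unique solutions of
   sqrt t * theta_j(...) = e^(- pi x^2) * (1 + R2j). *)
Definition R21 (x t : R) : C :=
  (RtoC (sqrt t) * theta1 (RtoC (1 / 2 + sqrt t * x)%R) (Ci * t)
   / RtoC (exp (- PI * x ^ 2)%R) - 1)%C.

Definition R22 (x t : R) : C :=
  (RtoC (sqrt t) * theta2 (RtoC (sqrt t * x)%R) (Ci * t)
   / RtoC (exp (- PI * x ^ 2)%R) - 1)%C.

Definition R23 (x t : R) : C :=
  (RtoC (sqrt t) * theta3 (RtoC (sqrt t * x)%R) (Ci * t)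
   / RtoC (exp (- PI * x ^ 2)%R) - 1)%C.

Definition R24 (x t : R) : C :=
  (RtoC (sqrt t) * theta4 (RtoC (1 / 2 + sqrt t * x)%R) (Ci * t)
   / RtoC (exp (- PI * x ^ 2)%R) - 1)%C.

(* Main.v *)
Require Import Defs.
From Stdlib Require Import Reals ZArith Lra Lia.
From Coquelicot Require Import Coquelicot.

Open Scope R_scope.

(** At real [v] and [tau = i t] the theta functions are real Gaussian series, and a
    shift of [v] by [1/2] turns [theta1] into [theta2] and [theta4] into [theta3].
    Jacobi's transformation
      [sqrt t * sum_n exp (- PI t n^2) cos (2 PI n v) = sum_n exp (- PI (n + v)^2 / t)]
    then rewrites [sqrt t * theta3] at [v = sqrt t * x] as a sum of narrow Gaussians.
    The term [n = 0] is [exp (- PI x^2)]; the others, divided by it, are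
    [exp (- (PI n^2 +- 2 PI n x sqrt t) / t)], and since [2 PI |x| sqrt t < eps] they
    are bounded by [exp (- (PI - eps) / t)] times a geometric series of ratio
    [exp (- PI)] ([gauss_tail_bound]).  For [theta2] the same transformation is used at
    [(t, v)] and at [(t / 4, v / 2)]: the difference of the two runs over half-integers
    on one side and carries the signs [(-1)^n] on the other, so that the absolute values
    obey the same bound ([jacobi_transformation_half]).

    Jacobi's transformation is obtained by Polya's elementary argument.  The binomial
    expansion of [cos^(2m)], summed over [l] equally spaced angles, keeps only the
    frequencies divisible by [l] ([finite_poisson]).  Let [l] tend to infinity with
    [m] about [l^2 / (PI t)].  The cosine powers tend to Gaussians in the node
    ([is_lim_seq_cos_power]), the binomial coefficients divided by the central one tend
    to Gaussians in the frequency ([is_lim_seq_walk]), and both passages to the limit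
    under the sum are dominated ([tannery]).  What remains is the factor
    [l * walk m 0], which is [sqrt (l^2 / m)] times a convergent sequence that does not
    involve [t] ([central_weight_lim]); hence the two sides agree up to [w * sqrt t] with
    a constant [w], and [w = 1] because at [t = 1], [v = 0] they are the same series. *)

(** * Sums and series *)

Lemma ex_series_Rle (a b : nat -> R) :
  (forall n, Rabs (a n) <= b n) -> ex_series b -> ex_series a.
Proof. exact (@ex_series_le R_AbsRing R_CompleteNormedModule a b). Qed.

Lemma is_lim_seq_sum_f_R0 (a : nat -> nat -> R) (a' : nat -> R) (K : nat) :
  (forall k, is_lim_seq (fun n => a n k) (a' k)) ->
  is_lim_seq (fun n => sum_f_R0 (a n) K) (sum_f_R0 a' K).
Proof.
intros H; induction K as [|K IH]; simpl; [apply H|].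
now apply is_lim_seq_plus'.
Qed.

Lemma Series_tail_lim (b : nat -> R) :
  ex_series b -> is_lim_seq (fun n => Series (fun k => b (S n + k)%nat)) 0.
Proof.
intros Hb.
apply is_lim_seq_ext with (fun n => Series b - sum_f_R0 b n).
{ intros n. rewrite (Series_incr_n b (S n)) by (lia || assumption). simpl; ring. }
replace (Finite 0) with (Finite (Series b - Series b)) by (f_equal; ring).
apply is_lim_seq_minus'; [apply is_lim_seq_const|].
apply is_lim_seq_ext with (sum_n b); [intros n; apply sum_n_Reals|].
exact (Series_correct b Hb).
Qed.

(** Dominated convergence for series: outside a finite set of indices the
    majorant makes every term negligible, uniformly in [n]. *)
Lemma tannery (a : nat -> nat -> R) (a' b : nat -> R) :
  (forall n k, Rabs (a n k) <= b k) -> ex_series b ->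
  (forall k, is_lim_seq (fun n => a n k) (a' k)) ->
  is_lim_seq (fun n => Series (a n)) (Series a').
Proof.
intros Hab Hb Hlim.
assert (Hab' : forall k, Rabs (a' k) <= b k).
{ intros k.
  apply (is_lim_seq_le (fun n => Rabs (a n k)) (fun _ => b k) (Rabs (a' k)) (b k)).
  - intros n; apply Hab.
  - apply (is_lim_seq_abs _ (Finite (a' k))), Hlim.
  - apply is_lim_seq_const. }
assert (Htail : forall (c : nat -> R) K, (forall k, Rabs (c k) <= b k) ->
   Rabs (Series c - sum_f_R0 c K) <= Series (fun k => b (S K + k)%nat)).
{ intros c K Hc.
  assert (Hbt : ex_series (fun k => b (S K + k)%nat)).
  { now apply (ex_series_incr_n b (S K)). }
  rewrite (Series_incr_n c (S K)); [|lia|now apply ex_series_Rle with b].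
  simpl pred.
  replace (sum_f_R0 c K + _ - _) with (Series (fun k => c (S K + k)%nat)) by ring.
  eapply Rle_trans.
  - apply Series_Rabs, ex_series_Rle with (2 := Hbt).
    intros n; rewrite Rabs_Rabsolu; apply Hc.
  - apply Series_le; [|exact Hbt].
    intros n; split; [apply Rabs_pos|apply Hc]. }
apply is_lim_seq_spec; intros eps; simpl.
assert (He : 0 < eps / 3) by (destruct eps; simpl; lra).
destruct (proj2 (is_lim_seq_spec _ _) (Series_tail_lim b Hb) (mkposreal _ He))
  as [K HK].
specialize (HK K (le_n K)); simpl in HK.
pose proof (is_lim_seq_sum_f_R0 a a' K Hlim) as HS.
destruct (proj2 (is_lim_seq_spec _ _) HS (mkposreal _ He)) as [N HN].
exists N; intros n Hn; specialize (HN n Hn); simpl in HN.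
pose proof (Htail (a n) K (Hab n)) as H1.
pose proof (Htail a' K Hab') as H2.
simpl in H1, H2.
apply Rabs_def2 in HK; apply Rabs_def2 in HN.
apply Rabs_le_between in H1; apply Rabs_le_between in H2.
apply Rabs_def1; lra.
Qed.

Lemma Series_finite (f : nat -> R) (K : nat) :
  (forall k, (K < k)%nat -> f k = 0) -> Series f = sum_f_R0 f K.
Proof.
intros Hf; apply is_series_unique.
apply (is_series_decr_n f (S K)); [lia|].
apply is_series_ext with (fun _ => 0).
{ intros n; symmetry; apply Hf; lia. }
simpl pred; rewrite sum_n_Reals.
replace (plus _ _) with 0 by (unfold plus, opp; simpl; ring).
apply is_series_Reals; intros e He; exists 0%nat; intros n _.
rewrite sum_eq_R0 by reflexivity.
now rewrite (proj2 (R_dist_refl 0 0)).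
Qed.

Lemma Series_ge0 (f : nat -> R) : (forall k, 0 <= f k) -> ex_series f -> 0 <= Series f.
Proof.
intros Hf Hex.
rewrite <- (Rmult_0_l (Series f)), <- Series_scal_l.
apply Series_le; [|exact Hex].
intros n; rewrite Rmult_0_l; split; [lra|apply Hf].
Qed.

Lemma Series_truncated (f : nat -> R) (K : nat) :
  Series (fun k => if (k <=? K)%nat then f k else 0) = sum_f_R0 f K.
Proof.
rewrite (Series_finite _ K).
- apply sum_eq; intros i Hi. now rewrite (proj2 (Nat.leb_le i K) Hi).
- intros k Hk. now rewrite (proj2 (Nat.leb_gt k K) Hk).
Qed.

Lemma Series_even_odd (a : nat -> R) :
  ex_series (fun n => a (2 * n)%nat) -> ex_series (fun n => a (2 * n + 1)%nat) ->
  ex_series a /\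
  Series a = Series (fun n => a (2 * n)%nat) + Series (fun n => a (2 * n + 1)%nat).
Proof.
intros H0 H1.
assert (Hone : forall (c : nat -> R) x l, x = 1 ->
          (is_pseries c x l <-> is_series c l)).
{ intros c x l ->; unfold is_pseries; split; apply is_series_ext; intros n;
    rewrite pow_n_pow, pow1; unfold scal; simpl; unfold mult; simpl; ring. }
assert (H : is_series a (Series (fun n => a (2 * n)%nat)
                         + 1 * Series (fun n => a (2 * n + 1)%nat))).
{ apply (Hone a 1); [reflexivity|]; apply is_pseries_odd_even; (apply Hone; [ring|]);
    now apply Series_correct. }
rewrite Rmult_1_l in H; split; [eexists; exact H|now apply is_series_unique].
Qed.

Lemma exp_mult_INR (c : R) (k : nat) : exp (c * INR k) = exp c ^ k.
Proof.
induction k as [|k IH]; [now rewrite Rmult_0_r, exp_0|].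
rewrite S_INR, Rmult_plus_distr_l, exp_plus, IH, Rmult_1_r; simpl; ring.
Qed.

Lemma Rabs_exp_neg_lt_1 (c : R) : 0 < c -> Rabs (exp (- c)) < 1.
Proof.
intros Hc; rewrite Rabs_pos_eq by apply Rlt_le, exp_pos.
rewrite <- exp_0; apply exp_increasing; lra.
Qed.

Lemma ex_series_exp (A c : R) :
  0 < c -> ex_series (fun k => A * exp (- c * INR k)).
Proof.
intros Hc.
apply ex_series_ext with (fun k => A * exp (- c) ^ k).
{ intros k; now rewrite exp_mult_INR. }
apply (ex_series_scal_l A (fun k => exp (- c) ^ k)).
now apply ex_series_geom, Rabs_exp_neg_lt_1.
Qed.

(** * Central binomial weights *)

(** [walk m r] is the binomial coefficient of [2m] over [m + r] divided by [4^m],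
    the probability that a walk of [2m] fair half-steps ends at [r].  Folding the
    recursion at [0] by the symmetry [r <-> -r] keeps [r] a natural number. *)
Fixpoint walk (m r : nat) {struct m} : R :=
  match m with
  | O => match r with O => 1 | S _ => 0 end
  | S m' => match r with
            | O => (2 * walk m' 0 + 2 * walk m' 1) / 4
            | S r' => (walk m' r' + 2 * walk m' r + walk m' (S r)) / 4
            end
  end.

Lemma walk_ge0 m r : 0 <= walk m r.
Proof.
revert r; induction m as [|m IH]; intros [|r]; simpl; try lra.
- pose proof (IH 0%nat); pose proof (IH 1%nat); lra.
- pose proof (IH r); pose proof (IH (S r)); pose proof (IH (S (S r))); lra.
Qed.

Lemma walk_0_gt0 m : 0 < walk m 0.
Proof.
induction m as [|m IH]; simpl; [lra|].
pose proof (walk_ge0 m 1); lra.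
Qed.

Lemma walk_out m r : (m < r)%nat -> walk m r = 0.
Proof.
revert r; induction m as [|m IH]; intros [|r] Hr; simpl; try lia; try lra.
rewrite !IH by lia; lra.
Qed.

Lemma walk_ratio m r :
  (INR m + INR r + 1) * walk m (S r) = (INR m - INR r) * walk m r.
Proof.
revert r; induction m as [|m IH]; intros r.
{ destruct r; simpl; lra. }
pose proof (pos_INR m) as Hm; pose proof (pos_INR r) as Hr.
assert (Hnext : forall s,
          walk m (S s) = (INR m - INR s) / (INR m + INR s + 1) * walk m s).
{ intros s; pose proof (pos_INR s).
  replace (_ / _ * _) with ((INR m - INR s) * walk m s / (INR m + INR s + 1))
    by (field; lra).
  rewrite <- IH; field; lra. }
destruct r as [|r].
- change (walk (S m) 1) with ((walk m 0 + 2 * walk m 1 + walk m 2) / 4).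
  change (walk (S m) 0) with ((2 * walk m 0 + 2 * walk m 1) / 4).
  rewrite (Hnext 1%nat), (Hnext 0%nat), S_INR; simpl INR; field; lra.
- change (walk (S m) (S (S r)))
    with ((walk m (S r) + 2 * walk m (S (S r)) + walk m (S (S (S r)))) / 4).
  change (walk (S m) (S r))
    with ((walk m r + 2 * walk m (S r) + walk m (S (S r))) / 4).
  rewrite (Hnext (S (S r))), (Hnext (S r)), (Hnext r), !S_INR.
  rewrite S_INR in Hr; pose proof (pos_INR r); field; lra.
Qed.

Lemma cos_sqr_mult (th u : R) :
  cos th ^ 2 * cos u = (cos (u - 2 * th) + 2 * cos u + cos (u + 2 * th)) / 4.
Proof.
rewrite cos_minus, cos_plus, cos_2a_cos; field.
Qed.

(** The recursion of [walk] is multiplication by [cos th ^ 2] read on cosine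
    coefficients; truncating at [N] leaves only a boundary term, which vanishes
    once [N] exceeds the degree. *)
Lemma cos_even_power_expansion (th : R) (m N : nat) : (m <= N)%nat ->
  cos th ^ (2 * m)
  = walk m 0 + 2 * sum_f_R0 (fun r => walk m (S r) * cos (2 * INR (S r) * th)) N.
Proof.
revert N; induction m as [|m IH]; intros N HN.
{ simpl walk.
  rewrite sum_eq_R0 by (intros; ring). simpl; ring. }
replace (2 * S m)%nat with (2 + 2 * m)%nat by lia.
rewrite pow_add, (IH N) by lia; clear IH.
assert (Hb : forall K,
  cos th ^ 2 * (walk m 0
     + 2 * sum_f_R0 (fun r => walk m (S r) * cos (2 * INR (S r) * th)) K)
  = walk (S m) 0
     + 2 * sum_f_R0 (fun r => walk (S m) (S r) * cos (2 * INR (S r) * th)) K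
     + (walk m (S K) * cos (2 * INR (S (S K)) * th)
        - walk m (S (S K)) * cos (2 * INR (S K) * th)) / 2).
{ assert (Hstep : forall s c, cos th ^ 2 * (c * cos (2 * INR (S s) * th)) =
    c * (cos (2 * INR s * th) + 2 * cos (2 * INR (S s) * th)
         + cos (2 * INR (S (S s)) * th)) / 4).
  { intros s c.
    replace (cos th ^ 2 * (c * _)) with (c * (cos th ^ 2 * cos (2 * INR (S s) * th)))
      by ring.
    rewrite cos_sqr_mult.
    replace (2 * INR (S s) * th - 2 * th) with (2 * INR s * th)
      by (rewrite S_INR; ring).
    replace (2 * INR (S s) * th + 2 * th) with (2 * INR (S (S s)) * th)
      by (rewrite (S_INR (S s)); ring).
    field. }
  induction K as [|K IHK].
  - unfold sum_f_R0.
    rewrite Rmult_plus_distr_l.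
    replace (cos th ^ 2 * (2 * (walk m 1 * cos (2 * INR 1 * th))))
      with (2 * (cos th ^ 2 * (walk m 1 * cos (2 * INR 1 * th)))) by ring.
    rewrite Hstep.
    replace (cos th ^ 2) with ((1 + cos (2 * INR 1 * th)) / 2)
      by (replace (2 * INR 1 * th) with (2 * th) by (simpl; ring);
          rewrite cos_2a_cos; field).
    replace (2 * INR 0 * th) with 0 by (simpl; ring).
    rewrite cos_0; simpl walk; field.
  - rewrite !tech5.
    set (x := walk m (S (S K)) * cos (2 * INR (S (S K)) * th)).
    match goal with |- _ * (?a + 2 * (?s + x)) = _ =>
      replace (cos th ^ 2 * (a + 2 * (s + x)))
        with (cos th ^ 2 * (a + 2 * s) + 2 * (cos th ^ 2 * x)) by ring end.
    rewrite IHK; unfold x; rewrite Hstep.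
    change (walk (S m) (S (S K)))
      with ((walk m (S K) + 2 * walk m (S (S K)) + walk m (S (S (S K)))) / 4).
    field. }
rewrite Hb, (walk_out m (S N)), (walk_out m (S (S N))) by lia; field.
Qed.

(** * Finite Poisson summation *)

Lemma dirichlet_kernel (phi : R) (N : nat) :
  sin (phi / 2) * (1 + 2 * sum_f_R0 (fun n => cos (INR (S n) * phi)) N)
  = sin ((2 * INR N + 3) * (phi / 2)).
Proof.
assert (Hps : forall u h, 2 * sin h * cos u = sin (u + h) - sin (u - h)).
{ intros u h; rewrite sin_plus, sin_minus; ring. }
induction N as [|N IH].
- unfold sum_f_R0. rewrite Rmult_plus_distr_l.
  replace (sin (phi / 2) * (2 * _)) with (2 * sin (phi / 2) * cos (INR 1 * phi))
    by ring.
  rewrite Hps; simpl INR.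
  replace (1 * phi + phi / 2) with ((2 * 0 + 3) * (phi / 2)) by field.
  replace (1 * phi - phi / 2) with (phi / 2) by field. ring.
- rewrite tech5, Rmult_plus_distr_l with (r1 := 2), <- Rplus_assoc,
    Rmult_plus_distr_l, IH.
  replace (sin (phi / 2) * (2 * _)) with (2 * sin (phi / 2) * cos (INR (S (S N)) * phi))
    by ring.
  rewrite Hps, !S_INR.
  replace ((INR N + 1 + 1) * phi + phi / 2) with ((2 * (INR N + 1) + 3) * (phi / 2))
    by field.
  replace ((INR N + 1 + 1) * phi - phi / 2) with ((2 * INR N + 3) * (phi / 2))
    by field. ring.
Qed.

(** The odd number [2N+3] of nodes makes them symmetric about [v], and is never [1],
    so that the paired nodes can be indexed by [0..N]. *)
Definition comb_sum (N : nat) (f : R -> R) (v : R) : R :=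
  f v + sum_f_R0 (fun n => f (v + INR (S n)) + f (v - INR (S n))) N.

Definition nodes (N : nat) : nat := 2 * N + 3.

Lemma INR_nodes N : INR (nodes N) = 2 * INR N + 3.
Proof. unfold nodes; rewrite plus_INR, mult_INR; simpl; ring. Qed.

Lemma comb_sum_ext N f g v :
  (forall u, f u = g u) -> comb_sum N f v = comb_sum N g v.
Proof.
intros H; unfold comb_sum; rewrite H; f_equal.
apply sum_eq; intros; now rewrite !H.
Qed.

Lemma comb_sum_plus N f g v :
  comb_sum N (fun u => f u + g u) v = comb_sum N f v + comb_sum N g v.
Proof.
unfold comb_sum.
rewrite (sum_eq _ (fun n => (f (v + INR (S n)) + f (v - INR (S n)))
   + (g (v + INR (S n)) + g (v - INR (S n))))) by (intros; ring).
rewrite sum_plus; ring.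
Qed.

Lemma comb_sum_scal N c f v :
  comb_sum N (fun u => c * f u) v = c * comb_sum N f v.
Proof.
unfold comb_sum.
rewrite Rmult_plus_distr_l, scal_sum; f_equal.
apply sum_eq; intros; ring.
Qed.

Lemma comb_sum_const N c v : comb_sum N (fun _ => c) v = INR (nodes N) * c.
Proof.
unfold comb_sum.
rewrite sum_cte, INR_nodes, S_INR; ring.
Qed.

Lemma comb_sum_sum N (F : nat -> R -> R) K v :
  comb_sum N (fun u => sum_f_R0 (fun r => F r u) K) v
  = sum_f_R0 (fun r => comb_sum N (F r) v) K.
Proof.
induction K as [|K IH]; simpl; [reflexivity|].
now rewrite comb_sum_plus, IH.
Qed.

Lemma comb_sum_cos N (w v : R) :
  comb_sum N (fun u => cos (w * u)) v
  = cos (w * v) * (1 + 2 * sum_f_R0 (fun n => cos (INR (S n) * w)) N).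
Proof.
unfold comb_sum.
rewrite (sum_eq _ (fun n => cos (INR (S n) * w) * (2 * cos (w * v)))).
- rewrite <- scal_sum; ring.
- intros n _; rewrite Rmult_plus_distr_l, Rmult_minus_distr_l, cos_plus, cos_minus.
  rewrite (Rmult_comm w (INR (S n))); ring.
Qed.

Lemma cos_2PI_mult (j : nat) : cos (INR j * (2 * PI)) = 1.
Proof.
replace (INR j * (2 * PI)) with (0 + 2 * INR j * PI) by ring.
now rewrite cos_period, cos_0.
Qed.

(** Orthogonality of characters of [Z/l]: at the [l] nodes a frequency that is a
    multiple of [l] is constant, and any other one sums to zero because its
    Dirichlet kernel has numerator [sin (r * PI)]. *)
Lemma comb_sum_multiple N (k : nat) (v : R) :
  comb_sum N (fun u => cos (2 * INR (k * nodes N) * (PI * u / INR (nodes N)))) v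
  = INR (nodes N) * cos (2 * PI * INR k * v).
Proof.
assert (Hl : INR (nodes N) <> 0) by (apply not_0_INR; unfold nodes; lia).
rewrite (comb_sum_ext N _ (fun u => cos (2 * PI * INR k * u))).
2: { intros u; rewrite mult_INR; f_equal; field; exact Hl. }
rewrite comb_sum_cos.
rewrite (sum_eq _ (fun _ => 1)).
- rewrite sum_cte, INR_nodes, S_INR; ring.
- intros n _.
  replace (INR (S n) * (2 * PI * INR k)) with (INR (S n * k) * (2 * PI))
    by (rewrite mult_INR; ring).
  apply cos_2PI_mult.
Qed.

Lemma comb_sum_nonmultiple N (r : nat) (v : R) : (r mod nodes N <> 0)%nat ->
  comb_sum N (fun u => cos (2 * INR r * (PI * u / INR (nodes N)))) v = 0.
Proof.
intros Hr.
assert (Hl : INR (nodes N) <> 0) by (apply not_0_INR; unfold nodes; lia).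
pose proof PI_RGT_0 as Hpi.
set (phi := 2 * PI * INR r / INR (nodes N)).
rewrite (comb_sum_ext N _ (fun u => cos (phi * u))).
2: { intros u; unfold phi; f_equal; field; exact Hl. }
rewrite comb_sum_cos.
assert (Hs : sin (phi / 2) <> 0).
{ intros H0; destruct (sin_eq_0_0 _ H0) as [k Hk]; apply Hr.
  assert (Hk' : IZR (Z.of_nat r) = IZR (k * Z.of_nat (nodes N))).
  { rewrite mult_IZR, <- !INR_IZR_INZ.
    apply Rmult_eq_reg_l with (PI / INR (nodes N)).
    - replace (PI / INR (nodes N) * INR r) with (phi / 2)
        by (unfold phi; field; exact Hl).
      rewrite Hk; field; exact Hl.
    - intros H; apply (Rmult_eq_compat_r (INR (nodes N))) in H.
      unfold Rdiv in H; rewrite Rmult_assoc, Rinv_l in H by exact Hl; lra. }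
  apply eq_IZR in Hk'.
  apply Nat2Z.inj; rewrite Nat2Z.inj_mod, Hk'.
  now rewrite Z.mod_mul by (unfold nodes; lia). }
pose proof (dirichlet_kernel phi N) as HD.
rewrite <- INR_nodes in HD.
replace (INR (nodes N) * (phi / 2)) with (0 + IZR (Z.of_nat r) * PI) in HD
  by (rewrite <- INR_IZR_INZ; unfold phi; field; exact Hl).
rewrite (sin_eq_0_1 (0 + _)) in HD by (exists (Z.of_nat r); ring).
destruct (Rmult_integral _ _ HD) as [H|H]; [contradiction|].
rewrite H; ring.
Qed.

Lemma sum_multiples (l K : nat) (F : nat -> R) : (0 < l)%nat ->
  (forall r, (r mod l <> 0)%nat -> F r = 0) ->
  sum_f_R0 (fun r => F (S r)) (l * S K - 1) = sum_f_R0 (fun k => F (S k * l)%nat) K.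
Proof.
intros Hl HF.
assert (Hblock : forall q j, (j < l)%nat -> (q * l <> 0 \/ j <> 0)%nat ->
   sum_f_R0 (fun r => F (S r)) (q * l + j - 1)
   = match q with O => 0 | S q' => sum_f_R0 (fun k => F (S k * l)%nat) q' end).
{ induction q as [|q IHq]; induction j as [|j IHj]; intros Hj H0.
  - lia.
  - destruct j as [|j].
    + simpl. apply HF. rewrite Nat.mod_small; lia.
    + replace (0 * l + S (S j) - 1)%nat with (S (0 * l + S j - 1)) by lia.
      rewrite tech5, IHj by lia.
      rewrite HF; [lra|].
      replace (S (S (0 * l + S j - 1))) with (S (S j)) by lia.
      rewrite Nat.mod_small; lia.
  - replace (S q * l + 0 - 1)%nat with (S q * l - 1)%nat by lia.
    destruct (Nat.eq_dec (q * l + (l - 1)) 0) as [E|E].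
    + assert (q = 0 /\ l = 1)%nat as [-> ->] by nia. reflexivity.
    + replace (S q * l - 1)%nat with (S (q * l + (l - 1) - 1)) by nia.
      rewrite tech5, IHq by lia.
      replace (S (S (q * l + (l - 1) - 1))) with (S q * l)%nat by nia.
      destruct q; [simpl; lra|now rewrite tech5].
  - replace (S q * l + S j - 1)%nat with (S (S q * l + j - 1)) by nia.
    rewrite tech5, IHj by nia.
    rewrite HF; [lra|].
    replace (S (S (S q * l + j - 1))) with (S j + S q * l)%nat by nia.
    rewrite Nat.Div0.mod_add, Nat.mod_small; lia. }
replace (l * S K - 1)%nat with (S K * l + 0 - 1)%nat by nia.
rewrite Hblock by nia. reflexivity.
Qed.

(** Sampling the trigonometric polynomial [cos^(2m)] at [l] equally spaced nodes
    keeps exactly the frequencies divisible by [l].  The series on the right is a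
    finite sum, since [walk m] vanishes beyond [m]. *)
Lemma finite_poisson (N m : nat) (v : R) :
  comb_sum N (fun u => cos (PI * u / INR (nodes N)) ^ (2 * m)) v
  = INR (nodes N) * (walk m 0
      + 2 * Series (fun k => walk m (S k * nodes N) * cos (2 * PI * INR (S k) * v))).
Proof.
assert (Hl : (3 <= nodes N)%nat) by (unfold nodes; lia).
set (l := nodes N) in *.
rewrite (comb_sum_ext N _ (fun u => walk m 0
  + 2 * sum_f_R0 (fun r => walk m (S r) * cos (2 * INR (S r) * (PI * u / INR l)))
         (l * S m - 1))).
2: { intros u; apply cos_even_power_expansion; nia. }
rewrite comb_sum_plus, comb_sum_const, comb_sum_scal, comb_sum_sum; fold l.
set (F := fun r => walk m r
            * comb_sum N (fun u => cos (2 * INR r * (PI * u / INR l))) v).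
rewrite (sum_eq _ (fun r => F (S r))) by (intros; apply comb_sum_scal).
rewrite (sum_multiples l m F); [|lia|].
2: { intros r Hr; unfold F; rewrite comb_sum_nonmultiple by exact Hr; ring. }
rewrite (sum_eq _ (fun k => walk m (S k * l) * cos (2 * PI * INR (S k) * v) * INR l)).
2: { intros k _; unfold F, l; rewrite comb_sum_multiple; fold l; ring. }
rewrite <- scal_sum.
rewrite (Series_finite _ m).
2: { intros k Hk; rewrite walk_out by nia; ring. }
ring.
Qed.

(** * Limits of the weights and of the powers of the cosine *)

Lemma exp_le x y : x <= y -> exp x <= exp y.
Proof. intros [H| ->]; [now apply Rlt_le, exp_increasing|lra]. Qed.

Lemma is_lim_seq_exp (u : nat -> R) (l : R) :
  is_lim_seq u l -> is_lim_seq (fun n => exp (u n)) (exp l).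
Proof.
apply is_lim_seq_continuous, derivable_continuous_pt, derivable_pt_exp.
Qed.

Lemma is_lim_seq_neg (u : nat -> R) (l : R) :
  is_lim_seq u l -> is_lim_seq (fun n => - u n) (- l).
Proof. intros H; now apply (is_lim_seq_opp u l). Qed.

(** Each ratio of consecutive weights is [1 - (2j+1) / (m+j+1)], hence at most
    [exp (- (2j+1) / (m+q))] as long as [j < q]; the odd numbers add up to [r^2]. *)
Lemma walk_le_exp m r q : (0 < m)%nat -> (r <= q)%nat ->
  walk m r <= walk m 0 * exp (- (INR r ^ 2 / (INR m + INR q))).
Proof.
intros Hm Hrq.
assert (Hm' : 0 < INR m) by now apply lt_0_INR.
pose proof (pos_INR q) as Hq.
induction r as [|r IH].
{ replace (- _) with 0 by (simpl; field; lra). rewrite exp_0; lra. }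
specialize (IH ltac:(lia)).
pose proof (pos_INR r) as Hr.
assert (Hrq' : INR r + 1 <= INR q) by (rewrite <- S_INR; now apply le_INR).
assert (E : walk m (S r) = (1 - (2 * INR r + 1) / (INR m + INR r + 1)) * walk m r).
{ apply Rmult_eq_reg_l with (INR m + INR r + 1); [|lra].
  rewrite walk_ratio; field; lra. }
rewrite E, S_INR.
replace (- ((INR r + 1) ^ 2 / (INR m + INR q)))
  with (- ((2 * INR r + 1) / (INR m + INR q)) + - (INR r ^ 2 / (INR m + INR q)))
  by (field; lra).
rewrite exp_plus.
apply Rle_trans with (exp (- ((2 * INR r + 1) / (INR m + INR q))) * walk m r).
- apply Rmult_le_compat_r; [apply walk_ge0|].
  apply Rle_trans with (2 := exp_ineq1_le _).
  enough ((2 * INR r + 1) / (INR m + INR q)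
          <= (2 * INR r + 1) / (INR m + INR r + 1)) by lra.
  apply Rmult_le_compat_l; [lra|]. apply Rinv_le_contravar; lra.
- rewrite (Rmult_comm (walk m 0)), Rmult_assoc, (Rmult_comm _ (walk m 0)).
  apply Rmult_le_compat_l; [apply Rlt_le, exp_pos|exact IH].
Qed.

(** The inverse ratios are [1 + (2j+1) / (m-j)], at most [exp ((2j+1) / (m-q))]
    for [j < q]; the exponents again add up to a multiple of [r^2]. *)
Lemma walk_ge_exp m r q : (q < m)%nat -> (r <= q)%nat ->
  walk m 0 * exp (- (INR r ^ 2 / (INR m - INR q))) <= walk m r.
Proof.
intros Hm Hrq.
assert (Hm' : INR q < INR m) by now apply lt_INR.
pose proof (pos_INR q) as Hq.
induction r as [|r IH].
{ replace (- _) with 0 by (simpl; field; lra). rewrite exp_0; lra. }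
specialize (IH ltac:(lia)).
pose proof (pos_INR r) as Hr.
assert (Hrq' : INR r + 1 <= INR q) by (rewrite <- S_INR; now apply le_INR).
assert (E : walk m r = (1 + (2 * INR r + 1) / (INR m - INR r)) * walk m (S r)).
{ apply Rmult_eq_reg_l with (INR m - INR r); [|lra].
  rewrite <- walk_ratio; field; lra. }
assert (H : walk m r <= exp ((2 * INR r + 1) / (INR m - INR q)) * walk m (S r)).
{ rewrite E at 1; apply Rmult_le_compat_r; [apply walk_ge0|].
  apply Rle_trans with (2 := exp_ineq1_le _).
  apply Rplus_le_compat_l, Rmult_le_compat_l; [lra|].
  apply Rinv_le_contravar; lra. }
replace (- (INR (S r) ^ 2 / (INR m - INR q)))
  with (- ((2 * INR r + 1) / (INR m - INR q)) + - (INR r ^ 2 / (INR m - INR q)))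
  by (rewrite S_INR; field; lra).
rewrite exp_plus.
apply Rmult_le_reg_l with (exp ((2 * INR r + 1) / (INR m - INR q)));
  [apply exp_pos|].
apply Rle_trans with (2 := H).
apply Rle_trans with (2 := IH).
set (d := (2 * INR r + 1) / _); set (e := exp (- (INR r ^ 2 / _))).
replace (exp d * (walk m 0 * (exp (- d) * e)))
  with (exp d * exp (- d) * (walk m 0 * e)) by ring.
rewrite <- exp_plus, Rplus_opp_r, exp_0; lra.
Qed.

(** The power [2m] that balances [l] nodes: [m] is about [l^2 / (PI t)], which makes
    [cos (PI u / l) ^ (2m)] tend to [exp (- PI u^2 / t)]. *)
Definition half_power (t : R) (N : nat) : nat :=
  Z.to_nat (up (INR (nodes N) ^ 2 / (PI * t))).

Lemma nodes_ge1 N : 1 <= INR (nodes N).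
Proof. rewrite INR_nodes; pose proof (pos_INR N); lra. Qed.

Lemma half_power_bounds t N : 0 < t ->
  INR (nodes N) ^ 2 / (PI * t) < INR (half_power t N)
  <= INR (nodes N) ^ 2 / (PI * t) + 1.
Proof.
intros Ht; pose proof PI_RGT_0; pose proof (nodes_ge1 N).
set (y := INR (nodes N) ^ 2 / (PI * t)).
assert (Hy : 0 < y).
{ apply Rdiv_lt_0_compat; [apply pow_lt; lra|now apply Rmult_lt_0_compat]. }
destruct (archimed y) as [H1 H2].
unfold half_power; fold y.
rewrite INR_IZR_INZ, Z2Nat.id by (apply le_IZR; lra).
lra.
Qed.

Lemma is_lim_seq_nodes : is_lim_seq (fun N => INR (nodes N)) p_infty.
Proof.
apply is_lim_seq_le_p_loc with INR; [|apply is_lim_seq_INR].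
exists 0%nat; intros N _; rewrite INR_nodes; pose proof (pos_INR N); lra.
Qed.

Lemma is_lim_seq_inv_nodes : is_lim_seq (fun N => / INR (nodes N)) 0.
Proof.
apply (is_lim_seq_inv _ p_infty); [apply is_lim_seq_nodes|discriminate].
Qed.

Lemma is_lim_seq_half_power t : 0 < t ->
  is_lim_seq (fun N => INR (half_power t N) / INR (nodes N) ^ 2) (/ (PI * t)).
Proof.
intros Ht; pose proof PI_RGT_0.
apply is_lim_seq_le_le
  with (fun _ => / (PI * t)) (fun N => / (PI * t) + / INR (nodes N) * / INR (nodes N)).
- intros N; pose proof (nodes_ge1 N); destruct (half_power_bounds t N Ht) as [H1 H2].
  assert (Hl : 0 < INR (nodes N) ^ 2) by (apply pow_lt; lra).
  split; apply Rmult_le_reg_r with (INR (nodes N) ^ 2); try exact Hl.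
  + replace (INR (half_power t N) / INR (nodes N) ^ 2 * INR (nodes N) ^ 2)
      with (INR (half_power t N)) by (field; lra).
    replace (/ (PI * t) * INR (nodes N) ^ 2) with (INR (nodes N) ^ 2 / (PI * t))
      by (field; lra). lra.
  + replace (INR (half_power t N) / INR (nodes N) ^ 2 * INR (nodes N) ^ 2)
      with (INR (half_power t N)) by (field; lra).
    replace ((/ (PI * t) + / INR (nodes N) * / INR (nodes N)) * INR (nodes N) ^ 2)
      with (INR (nodes N) ^ 2 / (PI * t) + 1) by (field; lra). lra.
- apply is_lim_seq_const.
- replace (Finite (/ (PI * t))) with (Finite (/ (PI * t) + 0 * 0)) by (f_equal; ring).
  apply is_lim_seq_plus'; [apply is_lim_seq_const|].
  apply is_lim_seq_mult'; apply is_lim_seq_inv_nodes.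
Qed.

Lemma half_power_gt0 t N : 0 < t -> 0 < INR (half_power t N).
Proof.
intros Ht; destruct (half_power_bounds t N Ht) as [H _].
apply Rlt_trans with (2 := H); pose proof PI_RGT_0; pose proof (nodes_ge1 N).
apply Rdiv_lt_0_compat; [apply pow_lt; lra|now apply Rmult_lt_0_compat].
Qed.

Lemma is_lim_seq_nodes_sqr t : 0 < t ->
  is_lim_seq (fun N => INR (nodes N) ^ 2 / INR (half_power t N)) (PI * t).
Proof.
intros Ht; pose proof PI_RGT_0.
assert (Hp : 0 < PI * t) by now apply Rmult_lt_0_compat.
apply is_lim_seq_ext
  with (fun N => / (INR (half_power t N) / INR (nodes N) ^ 2)).
{ intros N; pose proof (nodes_ge1 N); pose proof (half_power_gt0 t N Ht).
  field; split; lra. }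
replace (Finite (PI * t)) with (Rbar_inv (Finite (/ (PI * t))))
  by (simpl; f_equal; apply Rinv_inv).
apply is_lim_seq_inv; [now apply is_lim_seq_half_power|].
intros E; injection E; apply Rgt_not_eq; now apply Rinv_0_lt_compat.
Qed.

Lemma is_lim_seq_nodes_over_half_power t : 0 < t ->
  is_lim_seq (fun N => INR (nodes N) / INR (half_power t N)) 0.
Proof.
intros Ht.
apply is_lim_seq_ext
  with (fun N => INR (nodes N) ^ 2 / INR (half_power t N) * / INR (nodes N)).
{ intros N; pose proof (nodes_ge1 N); pose proof (half_power_gt0 t N Ht).
  field; lra. }
replace (Finite 0) with (Finite (PI * t * 0)) by (f_equal; ring).
apply is_lim_seq_mult'; [now apply is_lim_seq_nodes_sqr|apply is_lim_seq_inv_nodes].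
Qed.

(** Local limit theorem relative to the central weight; the bounds [walk_le_exp] and
    [walk_ge_exp] squeeze the ratio since [r = k l] is negligible against [m]. *)
Lemma is_lim_seq_walk t k : 0 < t ->
  is_lim_seq (fun N => walk (half_power t N) (k * nodes N) / walk (half_power t N) 0)
             (exp (- (PI * t * INR k ^ 2))).
Proof.
intros Ht; pose proof PI_RGT_0.
set (m := half_power t).
(* [e = r / m], so the squeezing exponents are [k^2 (l^2 / m) / (1 +- e)]. *)
set (e := fun N => INR k * (INR (nodes N) / INR (m N))).
assert (He : is_lim_seq e 0).
{ replace (Finite 0) with (Finite (INR k * 0)) by (f_equal; ring).
  apply is_lim_seq_mult'; [apply is_lim_seq_const|].
  now apply is_lim_seq_nodes_over_half_power. }
assert (Hexp : forall s : R, is_lim_seq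
   (fun N => exp (- (INR k ^ 2 * (INR (nodes N) ^ 2 / INR (m N)) * / (1 + s * e N))))
   (exp (- (PI * t * INR k ^ 2)))).
{ intros s; apply is_lim_seq_exp.
  replace (- (PI * t * INR k ^ 2))
    with (- (INR k ^ 2 * (PI * t) * / (1 + s * 0))) by (field).
  apply is_lim_seq_neg.
  apply is_lim_seq_mult'; [apply is_lim_seq_mult'|].
  - apply is_lim_seq_const.
  - now apply is_lim_seq_nodes_sqr.
  - apply (is_lim_seq_inv _ (Finite (1 + s * 0))).
    + apply is_lim_seq_plus'; [apply is_lim_seq_const|].
      apply is_lim_seq_mult'; [apply is_lim_seq_const|exact He].
    + intros E; injection E; lra. }
apply is_lim_seq_le_le_loc with (2 := Hexp (-1)) (3 := Hexp 1).
destruct (proj2 (is_lim_seq_spec _ _) He (mkposreal 1 Rlt_0_1)) as [N0 HN0].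
exists N0; intros N HN; specialize (HN0 N HN); simpl in HN0.
rewrite Rminus_0_r in HN0; apply Rabs_def2 in HN0.
pose proof (half_power_gt0 t N Ht) as Hm; fold m in Hm.
pose proof (walk_0_gt0 (m N)) as Hw.
assert (Hr : INR (k * nodes N) = e N * INR (m N)).
{ unfold e; rewrite mult_INR; field; lra. }
assert (Hr' : INR (k * nodes N) < INR (m N)) by (rewrite Hr; nra).
assert (Hexpo : forall s, 1 + s * e N <> 0 ->
  INR k ^ 2 * (INR (nodes N) ^ 2 / INR (m N)) * / (1 + s * e N)
  = INR (k * nodes N) ^ 2 / (INR (m N) + s * INR (k * nodes N))).
{ intros s Hs.
  replace (INR (m N) + s * INR (k * nodes N)) with (INR (m N) * (1 + s * e N))
    by (rewrite Hr; ring).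
  rewrite mult_INR; field; split; lra. }
split.
- apply Rmult_le_reg_l with (walk (m N) 0); [exact Hw|].
  replace (walk (m N) 0 * (walk (m N) (k * nodes N) / walk (m N) 0))
    with (walk (m N) (k * nodes N)) by (field; lra).
  rewrite Hexpo by lra.
  replace (INR (m N) + -1 * INR (k * nodes N)) with (INR (m N) - INR (k * nodes N))
    by ring.
  apply walk_ge_exp; [now apply INR_lt|lia].
- apply Rmult_le_reg_l with (walk (m N) 0); [exact Hw|].
  replace (walk (m N) 0 * (walk (m N) (k * nodes N) / walk (m N) 0))
    with (walk (m N) (k * nodes N)) by (field; lra).
  rewrite Hexpo by lra.
  rewrite Rmult_1_l.
  apply walk_le_exp; [|lia].
  apply INR_lt; exact Hm.
Qed.

(** Beyond [m] the weight vanishes, and for [r <= m] the exponent in [walk_le_exp] is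
    at least [r^2 / (2m)]; the quadratic decay in [k] is weakened to a geometric one. *)
Lemma walk_dominated t k N : 0 < t ->
  walk (half_power t N) (S k * nodes N) / walk (half_power t N) 0
  <= exp (- (/ (2 * (/ (PI * t) + 1))) * INR k).
Proof.
intros Ht; pose proof PI_RGT_0 as Hpi.
set (m := half_power t N); set (l := nodes N); set (r := (S k * l)%nat).
pose proof (half_power_gt0 t N Ht) as Hm; fold m in Hm.
pose proof (walk_0_gt0 m) as Hw.
pose proof (pos_INR k) as Hk.
assert (Hl : 1 <= INR l) by apply nodes_ge1.
destruct (le_lt_dec r m) as [Hrm|Hrm].
2: { rewrite walk_out by exact Hrm.
     unfold Rdiv; rewrite Rmult_0_l; apply Rlt_le, exp_pos. }
apply Rle_trans with (exp (- (INR r ^ 2 / (INR m + INR r)))).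
{ apply Rmult_le_reg_l with (walk m 0); [exact Hw|].
  replace (walk m 0 * (walk m r / walk m 0)) with (walk m r) by (field; lra).
  apply walk_le_exp; [now apply INR_lt|lia]. }
apply exp_le.
rewrite <- Ropp_mult_distr_l; apply Ropp_le_contravar.
assert (Hip : 0 < / (PI * t)) by (apply Rinv_0_lt_compat, Rmult_lt_0_compat; lra).
assert (Hml : INR m <= INR l ^ 2 * (/ (PI * t) + 1)).
{ destruct (half_power_bounds t N Ht) as [_ H]; fold m l in H.
  unfold Rdiv in H; nra. }
set (a := / (PI * t) + 1) in *.
apply le_INR in Hrm.
assert (Hr : INR r = (INR k + 1) * INR l) by (unfold r; rewrite mult_INR, S_INR; ring).
assert (Hr0 : 0 < INR r) by (rewrite Hr; nra).
assert (Hlk : INR l ^ 2 * INR k <= INR r ^ 2).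
{ rewrite Hr, Rpow_mult_distr, Rmult_comm.
  apply Rmult_le_compat_r; [apply pow2_ge_0|nra]. }
apply Rmult_le_reg_r with (2 * a * (INR m + INR r)).
{ apply Rmult_lt_0_compat; unfold a; lra. }
replace (/ (2 * a) * INR k * (2 * a * (INR m + INR r)))
  with (INR k * (INR m + INR r)) by (field; unfold a; lra).
replace (INR r ^ 2 / (INR m + INR r) * (2 * a * (INR m + INR r)))
  with (2 * a * INR r ^ 2) by (field; lra).
apply Rle_trans with (INR k * (2 * (INR l ^ 2 * a))).
- apply Rmult_le_compat_l; lra.
- replace (INR k * _) with (2 * a * (INR l ^ 2 * INR k)) by ring.
  apply Rmult_le_compat_l; [unfold a; lra|exact Hlk].
Qed.

Lemma is_lim_seq_sin_scaled (y : R) :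
  is_lim_seq (fun N => INR (nodes N) * sin (y / INR (nodes N))) y.
Proof.
destruct (Req_dec y 0) as [->|Hy].
{ apply is_lim_seq_ext with (fun _ => 0); [|apply is_lim_seq_const].
  intros N; unfold Rdiv; rewrite Rmult_0_l, sin_0; ring. }
apply is_lim_seq_ext
  with (fun N => y * (sin (y / INR (nodes N)) / (y / INR (nodes N)))).
{ intros N; pose proof (nodes_ge1 N); field; split; lra. }
replace (Finite y) with (Finite (y * 1)) by (f_equal; ring).
apply is_lim_seq_mult'; [apply is_lim_seq_const|].
apply (is_lim_comp_seq (fun z => sin z / z) _ 0 1).
- apply is_lim_sinc_0.
- exists 0%nat; intros N _ E; injection E; pose proof (nodes_ge1 N).
  apply Rmult_integral_contrapositive_currified; [exact Hy|].
  apply Rinv_neq_0_compat; lra.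
- replace (Finite 0) with (Finite (y * 0)) by (f_equal; ring).
  apply is_lim_seq_mult'; [apply is_lim_seq_const|apply is_lim_seq_inv_nodes].
Qed.

(** With [s = sin^2], [exp (- s / (1 - s)) <= 1 - s <= exp (- s)]; both exponents,
    multiplied by [m], have the same limit. *)
Lemma is_lim_seq_cos_power t u : 0 < t ->
  is_lim_seq (fun N => cos (PI * u / INR (nodes N)) ^ (2 * half_power t N))
             (exp (- PI * u ^ 2 / t)).
Proof.
intros Ht; pose proof PI_RGT_0.
set (m := half_power t).
set (s := fun N => sin (PI * u / INR (nodes N)) ^ 2).
assert (Hms : is_lim_seq (fun N => INR (m N) * s N) (PI * u ^ 2 / t)).
{ apply is_lim_seq_ext with (fun N => INR (m N) / INR (nodes N) ^ 2 *
    (INR (nodes N) * sin (PI * u / INR (nodes N))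
     * (INR (nodes N) * sin (PI * u / INR (nodes N))))).
  { intros N; unfold s; pose proof (nodes_ge1 N); field; lra. }
  replace (PI * u ^ 2 / t) with (/ (PI * t) * (PI * u * (PI * u)))
    by (field; lra).
  apply is_lim_seq_mult'; [now apply is_lim_seq_half_power|].
  apply is_lim_seq_mult'; apply is_lim_seq_sin_scaled. }
assert (Hs : is_lim_seq s 0).
{ apply is_lim_seq_ext with (fun N =>
    (INR (nodes N) * sin (PI * u / INR (nodes N)) * / INR (nodes N))
    * (INR (nodes N) * sin (PI * u / INR (nodes N)) * / INR (nodes N))).
  { intros N; unfold s; pose proof (nodes_ge1 N); field; lra. }
  replace (Finite 0) with (Finite ((PI * u * 0) * (PI * u * 0))) by (f_equal; ring).
  apply is_lim_seq_mult'; (apply is_lim_seq_mult';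
    [apply is_lim_seq_sin_scaled|apply is_lim_seq_inv_nodes]). }
apply is_lim_seq_le_le_loc
  with (fun N => exp (- (INR (m N) * s N * / (1 - s N))))
       (fun N => exp (- (INR (m N) * s N))).
- destruct (proj2 (is_lim_seq_spec _ _) Hs (mkposreal 1 Rlt_0_1)) as [N0 HN0].
  exists N0; intros N HN; specialize (HN0 N HN); simpl in HN0.
  rewrite Rminus_0_r in HN0; apply Rabs_def2 in HN0.
  assert (E : cos (PI * u / INR (nodes N)) ^ (2 * m N) = (1 - s N) ^ m N).
  { rewrite pow_mult; f_equal; unfold s.
    pose proof (sin2_cos2 (PI * u / INR (nodes N))) as Hsc.
    unfold Rsqr in Hsc; lra. }
  rewrite E; split.
  + replace (- (INR (m N) * s N * / (1 - s N)))
      with (- (s N / (1 - s N)) * INR (m N)) by (field; lra).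
    rewrite exp_mult_INR; apply pow_incr; split; [apply Rlt_le, exp_pos|].
    rewrite exp_Ropp.
    replace (1 - s N) with (/ (1 + s N / (1 - s N))) at 2 by (field; lra).
    apply Rinv_le_contravar; [|apply exp_ineq1_le].
    replace (1 + s N / (1 - s N)) with (/ (1 - s N)) by (field; lra).
    apply Rinv_0_lt_compat; lra.
  + replace (- (INR (m N) * s N)) with (- s N * INR (m N)) by ring.
    rewrite exp_mult_INR; apply pow_incr; split; [lra|].
    pose proof (exp_ineq1_le (- s N)); lra.
- apply is_lim_seq_exp.
  replace (- PI * u ^ 2 / t) with (- (PI * u ^ 2 / t * / (1 - 0))) by (field; lra).
  apply is_lim_seq_neg, is_lim_seq_mult'; [exact Hms|].
  apply (is_lim_seq_inv _ (Finite (1 - 0))); [|intros E; injection E; lra].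
  apply is_lim_seq_minus'; [apply is_lim_seq_const|exact Hs].
- apply is_lim_seq_exp.
  replace (- PI * u ^ 2 / t) with (- (PI * u ^ 2 / t)) by (field; lra).
  now apply is_lim_seq_neg.
Qed.

Lemma cos_le_exp z : Rabs z <= PI / 2 -> 0 <= cos z <= exp (- (z ^ 2 / 3)).
Proof.
intros Hz; apply Rabs_le_between in Hz.
pose proof PI_4; pose proof PI_RGT_0.
split; [apply cos_ge_0; lra|].
apply Rle_trans with (2 := exp_ineq1_le _).
destruct (cos_bound z 0) as [_ H1]; [lra|lra|].
replace (cos_approx z (2 * (0 + 1))) with (1 - z ^ 2 / 2 + z ^ 4 / 24) in H1.
2: { unfold cos_approx, cos_term; simpl; field. }
(* For [z^2 <= 4] the quartic Taylor term is at most [z^2 / 6]. *)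
assert (z ^ 2 <= 4) by nra.
replace (z ^ 4) with (z ^ 2 * z ^ 2) in H1 by ring.
pose proof (pow2_ge_0 z); nra.
Qed.

(** All [l] nodes lie in [[-l/2, l/2]] when [|v| <= 1/2], so the cosine is taken at
    angles of modulus at most [PI / 2], where it is below a Gaussian. *)
Lemma cos_power_dominated t u N : 0 < t -> Rabs u <= INR (nodes N) / 2 ->
  0 <= cos (PI * u / INR (nodes N)) ^ (2 * half_power t N)
    <= exp (- (2 * PI / (3 * t)) * u ^ 2).
Proof.
intros Ht Hu; pose proof PI_RGT_0; pose proof (nodes_ge1 N) as Hl.
set (l := INR (nodes N)) in *; set (m := half_power t N).
assert (Hz : Rabs (PI * u / l) <= PI / 2).
{ replace (PI * u / l) with (PI / l * u) by (field; lra).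
  rewrite Rabs_mult, Rabs_pos_eq by (apply Rlt_le, Rdiv_lt_0_compat; lra).
  replace (PI / 2) with (PI / l * (l / 2)) by (field; lra).
  apply Rmult_le_compat_l; [apply Rlt_le, Rdiv_lt_0_compat; lra|exact Hu]. }
destruct (cos_le_exp _ Hz) as [H0 H1].
split; [now apply pow_le|].
apply Rle_trans with (exp (- ((PI * u / l) ^ 2 / 3)) ^ (2 * m)).
{ now apply pow_incr. }
rewrite <- exp_mult_INR; apply exp_le.
rewrite mult_INR; change (INR 2) with (1 + 1).
destruct (half_power_bounds t N Ht) as [Hm _]; fold l m in Hm.
replace (- (2 * PI / (3 * t)) * u ^ 2)
  with (- (2 / 3 * (PI * u / l) ^ 2 * (l ^ 2 / (PI * t)))) by (field; lra).
replace (- ((PI * u / l) ^ 2 / 3) * ((1 + 1) * INR m))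
  with (- (2 / 3 * (PI * u / l) ^ 2 * INR m)) by (field; lra).
apply Ropp_le_contravar, Rmult_le_compat_l; [|lra].
pose proof (pow2_ge_0 (PI * u / l)); lra.
Qed.

(** * The Jacobi transformation *)

(** The sum of [exp (- PI t n^2) cos (2 PI n v)] over all integers [n], folded by
    [n <-> -n]. *)
Definition gauss_cos_sum (t v : R) : R :=
  1 + 2 * Series (fun k => exp (- (PI * t * INR (S k) ^ 2))
                           * cos (2 * PI * INR (S k) * v)).

Definition gauss_pair (t v : R) (n : nat) : R :=
  exp (- PI * (v + INR n) ^ 2 / t) + exp (- PI * (v - INR n) ^ 2 / t).

(** The Gaussian [exp (- PI v^2 / t)] made periodic in [v], its translates by [n] and
    [-n] being grouped. *)
Definition gauss_shift_sum (t v : R) : R :=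
  exp (- PI * v ^ 2 / t) + Series (fun k => gauss_pair t v (S k)).

Lemma gauss_pair_bounds t v k : 0 < t -> Rabs v <= 1 / 2 ->
  0 <= gauss_pair t v (S k) <= 2 * exp (- (PI / t) * INR k).
Proof.
intros Ht Hv; pose proof PI_RGT_0; pose proof (pos_INR k).
apply Rabs_le_between in Hv.
assert (Hf : forall u, INR k <= u ^ 2 ->
               0 <= exp (- PI * u ^ 2 / t) <= exp (- (PI / t) * INR k)).
{ intros u Hu; split; [apply Rlt_le, exp_pos|].
  apply exp_le.
  replace (- PI * u ^ 2 / t) with (- (PI / t * u ^ 2)) by (field; lra).
  rewrite <- Ropp_mult_distr_l; apply Ropp_le_contravar, Rmult_le_compat_l; [|lra].
  apply Rlt_le, Rdiv_lt_0_compat; lra. }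
unfold gauss_pair.
pose proof (Hf (v + INR (S k)) ltac:(rewrite S_INR; nra)).
pose proof (Hf (v - INR (S k)) ltac:(rewrite S_INR; nra)).
lra.
Qed.

Lemma ex_series_gauss_pair t v : 0 < t -> Rabs v <= 1 / 2 ->
  ex_series (fun k => gauss_pair t v (S k)).
Proof.
intros Ht Hv; pose proof PI_RGT_0.
apply ex_series_Rle with (fun k => 2 * exp (- (PI / t) * INR k)).
- intros k; destruct (gauss_pair_bounds t v k Ht Hv).
  now rewrite Rabs_pos_eq.
- apply ex_series_exp, Rdiv_lt_0_compat; lra.
Qed.

Lemma weighted_side_lim t v : 0 < t ->
  is_lim_seq (fun N => 1 + 2 * Series (fun k =>
      walk (half_power t N) (S k * nodes N) / walk (half_power t N) 0
      * cos (2 * PI * INR (S k) * v)))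
    (gauss_cos_sum t v).
Proof.
intros Ht; pose proof PI_RGT_0.
assert (Hip : 0 < / (PI * t)) by (apply Rinv_0_lt_compat, Rmult_lt_0_compat; lra).
apply is_lim_seq_plus'; [apply is_lim_seq_const|].
apply is_lim_seq_mult'; [apply is_lim_seq_const|].
apply tannery with (fun k => 1 * exp (- (/ (2 * (/ (PI * t) + 1))) * INR k)).
- intros N k; rewrite Rabs_mult, Rmult_comm.
  apply Rmult_le_compat; try apply Rabs_pos.
  + apply Rabs_le, COS_bound.
  + rewrite Rabs_pos_eq; [now apply walk_dominated|].
    apply Rdiv_le_0_compat; [apply walk_ge0|apply walk_0_gt0].
- apply ex_series_exp, Rinv_0_lt_compat; lra.
- intros k; apply is_lim_seq_mult'; [|apply is_lim_seq_const].
  now apply is_lim_seq_walk.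
Qed.

Lemma cosine_side_lim t v : 0 < t -> Rabs v <= 1 / 2 ->
  is_lim_seq (fun N => comb_sum N
      (fun u => cos (PI * u / INR (nodes N)) ^ (2 * half_power t N)) v)
    (gauss_shift_sum t v).
Proof.
intros Ht Hv; pose proof PI_RGT_0.
apply is_lim_seq_plus'; [now apply is_lim_seq_cos_power|].
set (c := 2 * PI / (3 * t)).
assert (Hc : 0 < c) by (apply Rdiv_lt_0_compat; lra).
set (f := fun N u => cos (PI * u / INR (nodes N)) ^ (2 * half_power t N)).
apply is_lim_seq_ext with (fun N => Series (fun n => if (n <=? N)%nat
   then f N (v + INR (S n)) + f N (v - INR (S n)) else 0)).
{ intros N; apply Series_truncated. }
apply tannery with (fun k => 2 * exp (- c * INR k)).
- intros N n; destruct (Nat.leb_spec n N) as [Hn|Hn].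
  2: { rewrite Rabs_R0; pose proof (exp_pos (- c * INR n)); lra. }
  apply le_INR in Hn; pose proof (pos_INR n).
  apply Rabs_le_between in Hv.
  assert (Hf : forall u, Rabs u <= INR (nodes N) / 2 -> INR n <= u ^ 2 ->
                 0 <= f N u <= exp (- c * INR n)).
  { intros u H1 H2; destruct (cos_power_dominated t u N Ht H1) as [H3 H4].
    split; [exact H3|]; apply Rle_trans with (1 := H4), exp_le; fold c.
    rewrite <- !Ropp_mult_distr_l; apply Ropp_le_contravar, Rmult_le_compat_l; lra. }
  assert (Hp := Hf (v + INR (S n))); assert (Hq := Hf (v - INR (S n))).
  rewrite INR_nodes, S_INR in Hp, Hq; rewrite S_INR.
  assert (Hp' := Hp ltac:(apply Rabs_le; lra) ltac:(nra)).
  assert (Hq' := Hq ltac:(apply Rabs_le; lra) ltac:(nra)).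
  rewrite Rabs_pos_eq; lra.
- now apply ex_series_exp.
- intros n; apply is_lim_seq_ext_loc
    with (fun N => f N (v + INR (S n)) + f N (v - INR (S n))).
  { exists n; intros N HN; now rewrite (proj2 (Nat.leb_le n N) HN). }
  apply is_lim_seq_plus'; now apply is_lim_seq_cos_power.
Qed.

(** [sqrt m * walk m 0] increases and [(m + 1/2) * walk m 0 ^ 2] decreases.  The value
    of the limit (Wallis) is left open: [jacobi_transformation] determines it. *)
Lemma central_weight_lim :
  exists w : R, is_lim_seq (fun m => sqrt (INR m) * walk m 0) w.
Proof.
assert (Hrec : forall m, walk (S m) 0 = (2 * INR m + 1) / (2 * INR m + 2) * walk m 0).
{ intros m; pose proof (pos_INR m).
  assert (E : walk m 1 = INR m / (INR m + 1) * walk m 0).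
  { apply Rmult_eq_reg_l with (INR m + 1); [|lra].
    pose proof (walk_ratio m 0) as E; simpl INR in E.
    rewrite Rplus_0_r, Rminus_0_r in E; rewrite E; field; lra. }
  change (walk (S m) 0) with ((2 * walk m 0 + 2 * walk m 1) / 4).
  rewrite E; field; lra. }
destruct (ex_finite_lim_seq_incr (fun m => sqrt (INR m) * walk m 0) 1) as [w Hw].
- intros m; pose proof (pos_INR m) as Hm; rewrite Hrec, S_INR, <- Rmult_assoc.
  apply Rmult_le_compat_r; [apply walk_ge0|].
  rewrite <- (sqrt_pow2 ((2 * INR m + 1) / (2 * INR m + 2)))
    by (apply Rdiv_le_0_compat; lra).
  rewrite <- sqrt_mult by (lra || apply pow2_ge_0).
  apply sqrt_le_1_alt.
  apply Rmult_le_reg_r with (4 * (INR m + 1)); [lra|].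
  replace ((INR m + 1) * ((2 * INR m + 1) / (2 * INR m + 2)) ^ 2 * (4 * (INR m + 1)))
    with ((2 * INR m + 1) ^ 2) by (field; lra).
  nra.
- assert (Hdec : forall m, (INR m + 1 / 2) * walk m 0 ^ 2 <= 1 / 2).
  { induction m as [|m IH]; [simpl; lra|].
    apply Rle_trans with (2 := IH).
    pose proof (pos_INR m) as Hm; rewrite Hrec, S_INR, Rpow_mult_distr, <- Rmult_assoc.
    apply Rmult_le_compat_r; [apply pow2_ge_0|].
    apply Rmult_le_reg_r with ((2 * INR m + 2) ^ 2); [apply pow_lt; lra|].
    replace ((INR m + 1 + 1 / 2) * ((2 * INR m + 1) / (2 * INR m + 2)) ^ 2
             * (2 * INR m + 2) ^ 2)
      with ((INR m + 3 / 2) * (2 * INR m + 1) ^ 2) by (field; lra).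
    nra. }
  intros m; pose proof (pos_INR m) as Hm; pose proof (walk_ge0 m 0).
  rewrite <- sqrt_1.
  rewrite <- (sqrt_pow2 (walk m 0)) by assumption.
  rewrite <- sqrt_mult by (lra || apply pow2_ge_0).
  apply sqrt_le_1_alt.
  pose proof (Hdec m); pose proof (pow2_ge_0 (walk m 0)); nra.
- now exists w.
Qed.

Lemma half_power_unbounded t : 0 < t ->
  filterlim (half_power t) eventually eventually.
Proof.
intros Ht P [M HM]; pose proof PI_RGT_0.
assert (Hpt : 0 < PI * t) by now apply Rmult_lt_0_compat.
destruct (proj2 (is_lim_seq_spec _ _) is_lim_seq_nodes (INR M * (PI * t) + 1))
  as [N0 HN0].
exists N0; intros N HN; specialize (HN0 N HN).
apply HM, INR_le, Rlt_le.
destruct (half_power_bounds t N Ht) as [Hm _].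
apply Rlt_trans with (2 := Hm).
apply Rmult_lt_reg_r with (PI * t); [exact Hpt|].
replace (INR (nodes N) ^ 2 / (PI * t) * (PI * t)) with (INR (nodes N) ^ 2)
  by (field; lra).
pose proof (nodes_ge1 N); nra.
Qed.

Lemma transformation_up_to_constant :
  exists w : R, forall t v, 0 < t -> Rabs v <= 1 / 2 ->
    gauss_shift_sum t v = sqrt t * w * gauss_cos_sum t v.
Proof.
destruct central_weight_lim as [w Hw].
exists (sqrt PI * w); intros t v Ht Hv; pose proof PI_RGT_0.
assert (H1 := cosine_side_lim t v Ht Hv).
assert (H2 : is_lim_seq (fun N => sqrt (INR (nodes N) ^ 2 / INR (half_power t N))
     * (sqrt (INR (half_power t N)) * walk (half_power t N) 0)
     * (1 + 2 * Series (fun k =>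
      walk (half_power t N) (S k * nodes N) / walk (half_power t N) 0
      * cos (2 * PI * INR (S k) * v))))
     (sqrt (PI * t) * w * gauss_cos_sum t v)).
{ apply is_lim_seq_mult'; [apply is_lim_seq_mult'|now apply weighted_side_lim].
  - apply is_lim_seq_continuous; [|now apply is_lim_seq_nodes_sqr].
    apply continuity_pt_sqrt; nra.
  - apply (is_lim_seq_subseq (fun m => sqrt (INR m) * walk m 0) w);
      [now apply half_power_unbounded|exact Hw]. }
rewrite sqrt_mult in H2 by lra.
apply (is_lim_seq_ext _ (fun N => comb_sum N
      (fun u => cos (PI * u / INR (nodes N)) ^ (2 * half_power t N)) v)) in H2.
- apply is_lim_seq_unique in H1; apply is_lim_seq_unique in H2.
  rewrite H1 in H2; injection H2 as ->; ring.
- intros N; rewrite finite_poisson.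
  set (m := half_power t N); set (l := nodes N).
  pose proof (half_power_gt0 t N Ht) as Hm; fold m in Hm.
  pose proof (nodes_ge1 N) as Hl; fold l in Hl.
  pose proof (walk_0_gt0 m) as Hw0.
  rewrite <- Rmult_assoc, <- sqrt_mult
    by (try apply Rdiv_le_0_compat; try apply pow2_ge_0; lra).
  replace (INR l ^ 2 / INR m * INR m) with (INR l ^ 2) by (field; lra).
  rewrite sqrt_pow2, Rmult_assoc by lra.
  f_equal; rewrite Rmult_plus_distr_l, Rmult_1_r; f_equal.
  rewrite (Rmult_comm (walk m 0)), Rmult_assoc; f_equal.
  rewrite <- Series_scal_r; apply Series_ext; intros k.
  field; lra.
Qed.

(** At [t = 1], [v = 0] the two sides are the same series, which settles the constant. *)
Lemma jacobi_transformation (t v : R) : 0 < t -> Rabs v <= 1 / 2 ->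
  gauss_shift_sum t v = sqrt t * gauss_cos_sum t v.
Proof.
destruct transformation_up_to_constant as [w Hw].
assert (Heq : gauss_shift_sum 1 0 = gauss_cos_sum 1 0).
{ unfold gauss_shift_sum, gauss_cos_sum; f_equal.
  - rewrite <- exp_0 at 2; f_equal; field.
  - rewrite <- Series_scal_l; apply Series_ext; intros k; unfold gauss_pair.
    rewrite Rmult_0_r, cos_0.
    replace (- PI * (0 + INR (S k)) ^ 2 / 1) with (- (PI * 1 * INR (S k) ^ 2)) by field.
    replace (- PI * (0 - INR (S k)) ^ 2 / 1) with (- (PI * 1 * INR (S k) ^ 2)) by field.
    ring. }
assert (Hpos : 0 < gauss_shift_sum 1 0).
{ apply Rplus_lt_le_0_compat; [apply exp_pos|].
  apply (Series_ge0 (fun k => gauss_pair 1 0 (S k))).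
  - intros k; apply gauss_pair_bounds; rewrite ?Rabs_R0; lra.
  - apply ex_series_gauss_pair; rewrite ?Rabs_R0; lra. }
intros Ht Hv; rewrite (Hw t v Ht Hv).
assert (E := Hw 1 0 Rlt_0_1 ltac:(rewrite Rabs_R0; lra)).
rewrite sqrt_1, Rmult_1_l, <- Heq in E.
assert (w = 1) as ->; [|ring].
apply Rmult_eq_reg_r with (gauss_shift_sum 1 0); lra.
Qed.

(** The theta series with half-integer indices, folded by [n <-> -n-1]. *)
Definition gauss_half_cos_sum (t v : R) : R :=
  2 * Series (fun k => exp (- (PI * t * (INR k + 1 / 2) ^ 2))
                       * cos ((2 * INR k + 1) * PI * v)).

Lemma ex_series_gauss_cos (t a : R) (g : nat -> R) : 0 < t -> 0 <= a ->
  (forall k, INR k <= (INR k + a) ^ 2) ->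
  ex_series (fun k => exp (- (PI * t * (INR k + a) ^ 2)) * cos (g k)).
Proof.
intros Ht Ha Hk; pose proof PI_RGT_0.
assert (Hpt : 0 < PI * t) by now apply Rmult_lt_0_compat.
apply ex_series_Rle with (fun k => 1 * exp (- (PI * t) * INR k)).
2: now apply ex_series_exp.
intros k; rewrite Rabs_mult, Rmult_comm.
apply Rmult_le_compat; try apply Rabs_pos.
- apply Rabs_le, COS_bound.
- rewrite Rabs_pos_eq by apply Rlt_le, exp_pos.
  apply exp_le; rewrite <- Ropp_mult_distr_l.
  apply Ropp_le_contravar, Rmult_le_compat_l; [lra|apply Hk].
Qed.

Lemma ex_series_gauss_cos_sum t v : 0 < t ->
  ex_series (fun k => exp (- (PI * t * INR (S k) ^ 2)) * cos (2 * PI * INR (S k) * v)).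
Proof.
intros Ht.
apply ex_series_ext with (fun k => exp (- (PI * t * (INR k + 1) ^ 2))
                                   * cos (2 * PI * INR (S k) * v)).
{ intros k; now rewrite S_INR. }
apply ex_series_gauss_cos; [lra|lra|].
intros k; pose proof (pos_INR k); nra.
Qed.

Lemma ex_series_gauss_half_cos_sum t v : 0 < t ->
  ex_series (fun k => exp (- (PI * t * (INR k + 1 / 2) ^ 2))
                      * cos ((2 * INR k + 1) * PI * v)).
Proof.
intros Ht; apply ex_series_gauss_cos; [lra|lra|].
intros k; pose proof (pow2_ge_0 (INR k - 1 / 2)); nra.
Qed.

(** With [t / 4] and [v / 2] the index enters only through its half, which is an
    integer or a half-integer according to its parity. *)
Lemma gauss_cos_sum_split t v : 0 < t ->
  gauss_cos_sum (t / 4) (v / 2) = gauss_cos_sum t v + gauss_half_cos_sum t v.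
Proof.
intros Ht; unfold gauss_cos_sum, gauss_half_cos_sum.
set (a := fun k => exp (- (PI * (t / 4) * INR (S k) ^ 2))
                   * cos (2 * PI * INR (S k) * (v / 2))).
assert (Hev : forall n, exp (- (PI * t * (INR n + 1 / 2) ^ 2))
                   * cos ((2 * INR n + 1) * PI * v) = a (2 * n)%nat).
{ intros n; unfold a; rewrite S_INR, mult_INR; simpl (INR 2).
  f_equal; f_equal; field. }
assert (Hod : forall n, exp (- (PI * t * INR (S n) ^ 2)) * cos (2 * PI * INR (S n) * v)
                   = a (2 * n + 1)%nat).
{ intros n; unfold a; rewrite !S_INR, plus_INR, mult_INR; simpl (INR 2); simpl (INR 1).
  f_equal; f_equal; field. }
destruct (Series_even_odd a) as [_ E].
- apply (ex_series_ext _ _ Hev); now apply ex_series_gauss_half_cos_sum.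
- apply (ex_series_ext _ _ Hod); now apply ex_series_gauss_cos_sum.
- rewrite E, (Series_ext _ _ Hev), (Series_ext _ _ Hod); ring.
Qed.

Lemma gauss_pair_even t v k : 0 < t ->
  gauss_pair (t / 4) (v / 2) (S k) = gauss_pair t v (S (2 * k + 1)).
Proof.
intros Ht; unfold gauss_pair.
rewrite !S_INR, plus_INR, mult_INR; simpl (INR 2); simpl (INR 1).
f_equal; f_equal; field; lra.
Qed.

Lemma half_abs_le v : Rabs v <= 1 / 2 -> Rabs (v / 2) <= 1 / 2.
Proof.
intros Hv; apply Rabs_le_between in Hv; apply Rabs_le; lra.
Qed.

Lemma gauss_pair_split t v : 0 < t -> Rabs v <= 1 / 2 ->
  Series (fun k => gauss_pair t v (S k))
  = Series (fun k => gauss_pair t v (S (2 * k)))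
    + Series (fun k => gauss_pair t v (S (2 * k + 1)))
  /\ 0 <= Series (fun k => gauss_pair t v (S (2 * k)))
  /\ 0 <= Series (fun k => gauss_pair t v (S (2 * k + 1))).
Proof.
intros Ht Hv; pose proof PI_RGT_0.
assert (Hodd : ex_series (fun k => gauss_pair t v (S (2 * k)))).
{ apply ex_series_Rle with (fun k => 2 * exp (- (PI / t) * INR k)).
  2: apply ex_series_exp, Rdiv_lt_0_compat; lra.
  intros k; destruct (gauss_pair_bounds t v (2 * k) Ht Hv) as [H0 H1].
  rewrite Rabs_pos_eq by exact H0; apply Rle_trans with (1 := H1).
  apply Rmult_le_compat_l; [lra|apply exp_le].
  rewrite <- !Ropp_mult_distr_l.
  apply Ropp_le_contravar, Rmult_le_compat_l;
    [apply Rlt_le, Rdiv_lt_0_compat; lra|apply le_INR; lia]. }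
assert (Heven : ex_series (fun k => gauss_pair t v (S (2 * k + 1)))).
{ apply ex_series_ext with (fun k => gauss_pair (t / 4) (v / 2) (S k)).
  - intros k; now apply gauss_pair_even.
  - apply ex_series_gauss_pair; [lra|now apply half_abs_le]. }
split; [|split].
- now apply (Series_even_odd (fun k => gauss_pair t v (S k))).
- apply Series_ge0; [|exact Hodd]; intros k; now apply gauss_pair_bounds.
- apply Series_ge0; [|exact Heven]; intros k; now apply gauss_pair_bounds.
Qed.

(** Subtracting the transformation at [(t, v)] from the one at [(t / 4, v / 2)] turns
    half-integer indices into alternating signs. *)
Lemma jacobi_transformation_half t v : 0 < t -> Rabs v <= 1 / 2 ->
  sqrt t * gauss_half_cos_sum t v
  = exp (- PI * v ^ 2 / t) + (Series (fun k => gauss_pair t v (S (2 * k + 1)))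
                              - Series (fun k => gauss_pair t v (S (2 * k)))).
Proof.
intros Ht Hv.
assert (J1 := jacobi_transformation t v Ht Hv).
assert (J2 := jacobi_transformation (t / 4) (v / 2) ltac:(lra) (half_abs_le v Hv)).
rewrite gauss_cos_sum_split in J2 by exact Ht.
assert (Hs : sqrt (t / 4) = sqrt t / 2).
{ rewrite sqrt_div_alt by lra; f_equal.
  replace 4 with (2 * 2) by ring; apply sqrt_square; lra. }
rewrite Hs in J2.
unfold gauss_shift_sum in J1, J2.
rewrite (Series_ext _ _ (fun k => gauss_pair_even t v k Ht)) in J2.
replace (- PI * (v / 2) ^ 2 / (t / 4)) with (- PI * v ^ 2 / t) in J2 by (field; lra).
destruct (gauss_pair_split t v Ht Hv) as [Esplit _]; rewrite Esplit in J1.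
lra.
Qed.

(** * The theta functions on the imaginary axis *)

Lemma CSeriesZ_ext (a b : Z -> C) : (forall n, a n = b n) -> CSeriesZ a = CSeriesZ b.
Proof.
intros H; unfold CSeriesZ, CSeries.
f_equal; f_equal; apply Series_ext; intros n; now rewrite H.
Qed.

Lemma CSeriesZ_mult_Ci (a : Z -> C) :
  CSeriesZ (fun n => Ci * a n)%C = (Ci * CSeriesZ a)%C.
Proof.
assert (H : forall c : nat -> C, CSeries (fun n => Ci * c n)%C = (Ci * CSeries c)%C).
{ intros c; unfold CSeries; apply injective_projections; simpl.
  - rewrite (Series_ext _ (fun n => - Im (c n))) by (intros; unfold Re, Im; simpl; ring).
    rewrite Series_opp; ring.
  - rewrite (Series_ext _ (fun n => Re (c n))) by (intros; unfold Re, Im; simpl; ring).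
    ring. }
unfold CSeriesZ.
rewrite (H (fun n => a (Z.of_nat n))), (H (fun n => a (- Z.of_nat (S n))%Z)); ring.
Qed.

Lemma CSeriesZ_hermitian (a : Z -> C) :
  (forall n, a (- n)%Z = Cconj (a n)) ->
  ex_series (fun k => Re (a (Z.of_nat (S k)))) ->
  CSeriesZ a = RtoC (Re (a 0%Z) + 2 * Series (fun k => Re (a (Z.of_nat (S k))))).
Proof.
intros Ha Hex; unfold CSeriesZ, CSeries; apply injective_projections; cbn [Cplus RtoC fst snd].
- rewrite (Series_ext (fun n => Re (a (- Z.of_nat (S n))%Z))
             (fun k => Re (a (Z.of_nat (S k))))) by (intros; now rewrite Ha).
  rewrite (Series_incr_1 (fun n => Re (a (Z.of_nat n))))
    by now apply (ex_series_incr_1 (fun n => Re (a (Z.of_nat n)))).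
  change (Z.of_nat 0) with 0%Z; ring.
- rewrite (Series_incr_1_aux (fun n => Im (a (Z.of_nat n)))).
  2: { pose proof (f_equal Im (Ha 0%Z)) as E; change (- 0)%Z with 0%Z in E.
       unfold Cconj, Im in E |- *; simpl in E |- *; lra. }
  rewrite (Series_ext (fun n => Im (a (- Z.of_nat (S n))%Z))
             (fun k => - Im (a (Z.of_nat (S k))))) by (intros; now rewrite Ha).
  rewrite Series_opp; ring.
Qed.

Lemma CSeriesZ_half_hermitian (a : Z -> C) :
  (forall n, a (- n - 1)%Z = Cconj (a n)) ->
  CSeriesZ a = RtoC (2 * Series (fun k => Re (a (Z.of_nat k)))).
Proof.
intros Ha.
assert (Ha' : forall k, a (- Z.of_nat (S k))%Z = Cconj (a (Z.of_nat k))).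
{ intros k; rewrite <- Ha; f_equal; lia. }
unfold CSeriesZ, CSeries; apply injective_projections; cbn [Cplus RtoC fst snd].
- rewrite (Series_ext (fun n => Re (a (- Z.of_nat (S n))%Z))
             (fun k => Re (a (Z.of_nat k)))) by (intros; now rewrite Ha').
  ring.
- rewrite (Series_ext (fun n => Im (a (- Z.of_nat (S n))%Z))
             (fun k => - Im (a (Z.of_nat k)))) by (intros; now rewrite Ha').
  rewrite Series_opp; ring.
Qed.

Lemma qpow_imaginary (t s : R) : qpow (Ci * t) s = RtoC (exp (- (PI * t * s))).
Proof.
unfold qpow, Cexp.
replace (PI * Ci * (Ci * t) * s)%C with (RtoC (- (PI * t * s)))
  by (apply injective_projections; simpl; ring).
unfold Re, Im; simpl; rewrite cos_0, sin_0.
apply injective_projections; simpl; ring.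
Qed.

Definition cis (th : R) : C := (cos th, sin th).

Lemma Cexp_Ci (z : C) (th : R) : z = (0, th) -> Cexp z = cis th.
Proof.
intros ->; unfold Cexp, cis, Re, Im; simpl; rewrite exp_0.
apply injective_projections; simpl; ring.
Qed.

Lemma cis_opp th : cis (- th) = Cconj (cis th).
Proof. unfold cis, Cconj; simpl; now rewrite cos_neg, sin_neg. Qed.

Lemma cis_plus a b : cis (a + b) = (cis a * cis b)%C.
Proof.
unfold cis; rewrite cos_plus, sin_plus.
apply injective_projections; simpl; ring.
Qed.

Lemma cis_PI2 : cis (PI / 2) = Ci.
Proof. unfold cis, Ci; now rewrite cos_PI2, sin_PI2. Qed.

Lemma cis_int_PI (n : Z) : (RtoC (powerRZ (-1) n) * cis (IZR n * PI))%C = RtoC 1.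
Proof.
assert (Hcos : forall k, cos (IZR (2 * k) * PI) = 1).
{ intros k; replace (IZR (2 * k) * PI) with (2 * (IZR k * PI))
    by (rewrite mult_IZR; ring).
  rewrite cos_2a_sin, (sin_eq_0_1 (IZR k * PI)) by (now exists k); ring. }
assert (Hpow : forall k, powerRZ (-1) (2 * k) = 1).
{ intros k; replace (2 * k)%Z with (k + k)%Z by ring.
  rewrite powerRZ_add by lra; rewrite <- powerRZ_mult.
  replace (-1 * -1) with 1 by ring; apply powerRZ_R1. }
unfold cis; rewrite (sin_eq_0_1 (IZR n * PI)) by (now exists n).
destruct (Z.Even_or_Odd n) as [[k ->]|[k ->]].
- rewrite Hcos, Hpow; apply injective_projections; simpl; ring.
- rewrite plus_IZR, Rmult_plus_distr_r, Rmult_1_l, neg_cos, Hcos.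
  rewrite powerRZ_add, Hpow by lra.
  apply injective_projections; simpl; ring.
Qed.

Lemma theta3_imaginary (t v : R) : 0 < t ->
  theta3 v (Ci * t) = RtoC (gauss_cos_sum t v).
Proof.
intros Ht; unfold theta3.
set (a := fun n : Z => (RtoC (exp (- (PI * t * IZR n ^ 2))) * cis (2 * PI * IZR n * v))%C).
rewrite (CSeriesZ_ext _ a).
2: { intros n; unfold a; rewrite qpow_imaginary; f_equal; apply Cexp_Ci.
     apply injective_projections; simpl; ring. }
assert (Hre : forall k, exp (- (PI * t * INR (S k) ^ 2)) * cos (2 * PI * INR (S k) * v)
                        = Re (a (Z.of_nat (S k)))).
{ intros k; unfold a, Re; rewrite <- INR_IZR_INZ.
  cbn [Cmult RtoC cis fst snd]; ring. }
rewrite CSeriesZ_hermitian.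
- unfold gauss_cos_sum; rewrite (Series_ext _ _ Hre); do 2 f_equal.
  unfold a, Re; simpl.
  replace (- (PI * t * (0 * (0 * 1)))) with 0 by ring.
  replace (2 * PI * 0 * v) with 0 by ring.
  rewrite exp_0, cos_0; ring.
- intros n; unfold a; rewrite opp_IZR.
  replace (2 * PI * - IZR n * v) with (- (2 * PI * IZR n * v)) by ring.
  replace ((- IZR n) ^ 2) with (IZR n ^ 2) by ring.
  rewrite cis_opp; apply injective_projections; simpl; ring.
- apply (ex_series_ext _ _ Hre); now apply ex_series_gauss_cos_sum.
Qed.

Lemma theta2_imaginary (t v : R) :
  theta2 v (Ci * t) = RtoC (gauss_half_cos_sum t v).
Proof.
unfold theta2.
set (a := fun n : Z => (RtoC (exp (- (PI * t * (IZR n + 1 / 2) ^ 2)))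
                        * cis ((2 * IZR n + 1) * PI * v))%C).
rewrite (CSeriesZ_ext _ a).
2: { intros n; unfold a; rewrite qpow_imaginary; f_equal; apply Cexp_Ci.
     apply injective_projections; simpl; ring. }
rewrite CSeriesZ_half_hermitian.
- unfold gauss_half_cos_sum; do 2 f_equal; apply Series_ext; intros k.
  unfold a, Re; rewrite <- INR_IZR_INZ; cbn [Cmult RtoC cis fst snd]; ring.
- intros n; unfold a; rewrite minus_IZR, opp_IZR.
  replace ((2 * (- IZR n - 1) + 1) * PI * v) with (- ((2 * IZR n + 1) * PI * v)) by ring.
  replace ((- IZR n - 1 + 1 / 2) ^ 2) with ((IZR n + 1 / 2) ^ 2) by field.
  rewrite cis_opp; apply injective_projections; simpl; ring.
Qed.

Lemma theta4_half_shift (v : R) (tau : C) :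
  theta4 (RtoC (1 / 2 + v)) tau = theta3 v tau.
Proof.
apply CSeriesZ_ext; intros n.
rewrite (Cexp_Ci (2 * PI * Ci * IZR n * v) (2 * PI * IZR n * v))
  by (apply injective_projections; simpl; ring).
rewrite (Cexp_Ci _ (IZR n * PI + 2 * PI * IZR n * v))
  by (apply injective_projections; simpl; field).
rewrite cis_plus.
transitivity (RtoC (powerRZ (-1) n) * cis (IZR n * PI)
              * (qpow tau (IZR n ^ 2) * cis (2 * PI * IZR n * v)))%C; [ring|].
rewrite cis_int_PI; ring.
Qed.

Lemma theta1_half_shift (v : R) (tau : C) :
  theta1 (RtoC (1 / 2 + v)) tau = theta2 v tau.
Proof.
unfold theta1, theta2.
set (a := fun n : Z => (qpow tau ((IZR n + 1 / 2) ^ 2)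
                        * Cexp (RtoC (2 * IZR n + 1) * PI * Ci * v))%C).
rewrite (CSeriesZ_ext _ (fun n => Ci * a n)%C).
- rewrite CSeriesZ_mult_Ci, Cmult_assoc.
  replace (- Ci * Ci)%C with (RtoC 1) by (apply injective_projections; simpl; ring).
  ring.
- intros n; unfold a.
  rewrite (Cexp_Ci (RtoC (2 * IZR n + 1) * PI * Ci * v) ((2 * IZR n + 1) * PI * v))
    by (apply injective_projections; simpl; ring).
  rewrite (Cexp_Ci _ (IZR n * PI + (PI / 2 + (2 * IZR n + 1) * PI * v)))
    by (apply injective_projections; simpl; field).
  rewrite !cis_plus, cis_PI2.
  transitivity (RtoC (powerRZ (-1) n) * cis (IZR n * PI)
    * (Ci * (qpow tau ((IZR n + 1 / 2) ^ 2) * cis ((2 * IZR n + 1) * PI * v))))%C;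
    [ring|].
  rewrite cis_int_PI; ring.
Qed.

(** * The remainders *)

(** The exponent of the [n]-th shifted Gaussian is
    [- PI x^2 - (PI n^2 +- 2 PI n x sqrt t) / t].  The bound on [t] makes the cross term
    at most [eps n], and [PI n^2 - eps n - (PI - eps) >= PI t (n - 1)] leaves a
    geometric series of ratio [exp (- PI)]. *)
Lemma gauss_tail_bound (x eps t : R) :
  0 < t -> t < 1 -> eps < 1 -> 2 * PI * sqrt t * Rabs x <= eps ->
  Series (fun k => gauss_pair t (sqrt t * x) (S k))
  <= exp (- PI * x ^ 2) * (2 / (1 - exp (- PI)) * exp (- (PI - eps) / t)).
Proof.
intros Ht Ht1 He Hx; pose proof PI_RGT_0; pose proof PI2_3_2 as Hpi3.
set (s := sqrt t) in *.
assert (Hs : 0 < s) by now apply sqrt_lt_R0.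
assert (Hst : t = s * s) by (symmetry; apply sqrt_sqrt; lra).
set (A := 2 * (exp (- PI * x ^ 2) * exp (- (PI - eps) / t))).
assert (Hterm : forall y k, 2 * PI * s * Rabs y <= eps -> y ^ 2 = x ^ 2 ->
  exp (- PI * (s * y + INR (S k)) ^ 2 / t)
  <= exp (- PI * x ^ 2) * exp (- (PI - eps) / t) * exp (- PI * INR k)).
{ intros y k Hy Hyx; rewrite <- !exp_plus, <- Hyx; apply exp_le.
  pose proof (pos_INR k) as Hk; rewrite S_INR.
  assert (Hy' : - (2 * PI * s * y) <= eps).
  { apply Rle_trans with (2 := Hy).
    replace (- (2 * PI * s * y)) with (2 * PI * s * - y) by ring.
    apply Rmult_le_compat_l; [nra|].
    rewrite <- Rabs_Ropp; apply Rle_abs. }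
  apply Rmult_le_reg_r with t; [exact Ht|].
  replace (- PI * (s * y + (INR k + 1)) ^ 2 / t * t)
    with (- PI * y ^ 2 * t + - (2 * PI * s * y) * (INR k + 1) - PI * (INR k + 1) ^ 2)
    by (rewrite Hst; field; lra).
  replace ((- PI * y ^ 2 + - (PI - eps) / t + - PI * INR k) * t)
    with (- PI * y ^ 2 * t - (PI - eps) - PI * INR k * t) by (field; lra).
  assert (H1 : - (2 * PI * s * y) * (INR k + 1) <= eps * (INR k + 1))
    by (apply Rmult_le_compat_r; lra).
  assert (H2 : 0 <= INR k * (PI * (1 - t) + (PI - eps) + PI * INR k)).
  { apply Rmult_le_pos; [lra|].
    assert (0 <= PI * (1 - t)) by (apply Rmult_le_pos; lra).
    assert (0 <= PI * INR k) by (apply Rmult_le_pos; lra). lra. }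
  nra. }
assert (Hpair : forall k, gauss_pair t (s * x) (S k) <= A * exp (- PI * INR k)).
{ intros k; unfold gauss_pair, A.
  pose proof (Hterm x k Hx eq_refl) as H1.
  pose proof (Hterm (- x) k ltac:(rewrite Rabs_Ropp; exact Hx) ltac:(ring)) as H2.
  replace ((s * - x + INR (S k)) ^ 2) with ((s * x - INR (S k)) ^ 2) in H2 by ring.
  lra. }
apply Rle_trans with (Series (fun k => A * exp (- PI * INR k))).
- apply Series_le.
  + intros k; split; [|apply Hpair].
    apply Rlt_le, Rplus_lt_0_compat; apply exp_pos.
  + now apply ex_series_exp.
- rewrite Series_scal_l, (Series_ext _ (fun k => exp (- PI) ^ k))
    by (intros; apply exp_mult_INR).
  pose proof (Rabs_exp_neg_lt_1 PI ltac:(lra)) as Hq.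
  rewrite Series_geom by exact Hq.
  apply Rabs_def2 in Hq; apply Req_le; unfold A; field; lra.
Qed.

Lemma Cmod_remainder_le (a : C) (e D B : R) : 0 < e ->
  a = RtoC (e + D) -> Rabs D <= e * B -> Cmod (a / RtoC e - 1)%C <= B.
Proof.
intros He -> HD.
replace (RtoC (e + D) / RtoC e - 1)%C with (RtoC (D / e)).
- rewrite Cmod_R; unfold Rdiv; rewrite Rabs_mult, (Rabs_pos_eq (/ e))
    by (apply Rlt_le, Rinv_0_lt_compat, He).
  apply Rmult_le_reg_r with e; [exact He|].
  rewrite Rmult_assoc, Rinv_l by lra; lra.
- assert (RtoC e <> 0) by (intros E; apply RtoC_inj in E; lra).
  rewrite RtoC_div, RtoC_plus by lra; field; assumption.
Qed.

Theorem corollary3 (M x eps t : R)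
    (hM : 0 < M) (hx : Rabs x <= M)
    (heps0 : 0 < eps) (heps : eps < Rmin 1 (2 * M))
    (ht0 : 0 < t) (ht : t < eps ^ 2 / (4 * PI ^ 2 * M ^ 2)) :
  ((RtoC (sqrt t) * theta1 (RtoC (1 / 2 + sqrt t * x)%R) (Ci * t)
      = RtoC (exp (- PI * x ^ 2)%R) * (1 + R21 x t))%C /\
   (RtoC (sqrt t) * theta2 (RtoC (sqrt t * x)%R) (Ci * t)
      = RtoC (exp (- PI * x ^ 2)%R) * (1 + R22 x t))%C /\
   (RtoC (sqrt t) * theta3 (RtoC (sqrt t * x)%R) (Ci * t)
      = RtoC (exp (- PI * x ^ 2)%R) * (1 + R23 x t))%C /\
   (RtoC (sqrt t) * theta4 (RtoC (1 / 2 + sqrt t * x)%R) (Ci * t)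
      = RtoC (exp (- PI * x ^ 2)%R) * (1 + R24 x t))%C) /\
  (Cmod (R21 x t) <=
     (4 - 2 * exp (- PI)) / (1 - exp (- PI)) * exp (- (PI - eps) / t) /\
   Cmod (R22 x t) <=
     (4 - 2 * exp (- PI)) / (1 - exp (- PI)) * exp (- (PI - eps) / t) /\
   Cmod (R23 x t) <=
     (4 - 2 * exp (- PI)) / (1 - exp (- PI)) * exp (- (PI - eps) / t) /\
   Cmod (R24 x t) <=
     (4 - 2 * exp (- PI)) / (1 - exp (- PI)) * exp (- (PI - eps) / t)).
Proof.
assert (Hpi := PI_RGT_0).
assert (Hid : forall a : C, a = (RtoC (exp (- PI * x ^ 2))
                * (1 + (a / RtoC (exp (- PI * x ^ 2)) - 1)))%C).
{ intros a; field; intros E; apply RtoC_inj in E.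
  pose proof (exp_pos (- PI * x ^ 2)); lra. }
split; [repeat split; apply Hid|].
set (s := sqrt t).
assert (Hs : 0 < s) by now apply sqrt_lt_R0.
assert (Hss : s ^ 2 = t) by (apply pow2_sqrt; lra).
assert (He1 : eps < 1) by (apply Rlt_le_trans with (1 := heps), Rmin_l).
assert (He2 : eps < 2 * M) by (apply Rlt_le_trans with (1 := heps), Rmin_r).
assert (HsM : 2 * PI * s * M < eps).
{ apply Rnot_le_lt; intros H; apply (Rlt_not_le _ _ ht).
  apply Rmult_le_reg_r with (4 * PI ^ 2 * M ^ 2).
  { pose proof (pow_lt PI 2 Hpi); pose proof (pow_lt M 2 hM).
    apply Rmult_lt_0_compat; lra. }
  replace (eps ^ 2 / (4 * PI ^ 2 * M ^ 2) * (4 * PI ^ 2 * M ^ 2)) with (eps ^ 2)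
    by (field; lra).
  rewrite <- Hss.
  replace (s ^ 2 * (4 * PI ^ 2 * M ^ 2)) with ((2 * PI * s * M) ^ 2) by ring.
  apply pow_incr; lra. }
assert (Hsx : 2 * PI * s * Rabs x <= eps).
{ apply Rle_trans with (2 * PI * s * M); [|lra].
  apply Rmult_le_compat_l; [nra|exact hx]. }
assert (Hpi3 : 3 < PI) by (pose proof PI2_3_2; lra).
assert (Hs1 : s < 1).
{ apply Rnot_le_lt; intros H.
  assert (HM : M < PI * M) by nra.
  assert (PI * M <= s * (PI * M)) by nra. lra. }
assert (Ht1 : t < 1) by (rewrite <- Hss; nra).
assert (Hv : Rabs (s * x) <= 1 / 2).
{ rewrite Rabs_mult, (Rabs_pos_eq s) by lra.
  pose proof (Rabs_pos x).
  assert (0 <= s * Rabs x) by (apply Rmult_le_pos; lra). nra. }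
set (e := exp (- PI * x ^ 2)).
assert (He0 : 0 < e) by apply exp_pos.
assert (Hev : exp (- PI * (s * x) ^ 2 / t) = e).
{ unfold e; f_equal; rewrite <- Hss; field; lra. }
set (B := (4 - 2 * exp (- PI)) / (1 - exp (- PI)) * exp (- (PI - eps) / t)).
set (T := Series (fun k => gauss_pair t (s * x) (S k))).
assert (HT : T <= e * B).
{ apply Rle_trans with (1 := gauss_tail_bound x eps t ht0 Ht1 He1 Hsx).
  apply Rmult_le_compat_l; [lra|].
  apply Rmult_le_compat_r; [apply Rlt_le, exp_pos|].
  pose proof (Rabs_exp_neg_lt_1 PI Hpi) as Hq; apply Rabs_def2 in Hq.
  apply Rmult_le_compat_r; [apply Rlt_le, Rinv_0_lt_compat|]; lra. }
destruct (gauss_pair_split t (s * x) ht0 Hv) as [Esplit [Hodd Heven]].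
fold T in Esplit.
assert (H3 : Cmod (RtoC s * theta3 (RtoC (s * x)) (Ci * t) / RtoC e - 1)%C <= B).
{ apply (Cmod_remainder_le _ e T B He0).
  - rewrite theta3_imaginary, <- RtoC_mult by exact ht0.
    unfold s at 1; rewrite <- jacobi_transformation by assumption.
    unfold gauss_shift_sum; now rewrite Hev.
  - rewrite Rabs_pos_eq; lra. }
assert (H2 : Cmod (RtoC s * theta2 (RtoC (s * x)) (Ci * t) / RtoC e - 1)%C <= B).
{ apply (Cmod_remainder_le _ e
    (Series (fun k => gauss_pair t (s * x) (S (2 * k + 1)))
     - Series (fun k => gauss_pair t (s * x) (S (2 * k)))) B He0).
  - rewrite theta2_imaginary, <- RtoC_mult.
    unfold s at 1; rewrite jacobi_transformation_half by assumption.
    now rewrite Hev.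
  - apply Rabs_le; lra. }
unfold R21, R22, R23, R24; fold s e B.
rewrite theta1_half_shift, theta4_half_shift.
now repeat split.
Qed.
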